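(* Let $\mathcal{O}_{K,S}$ be a ring of $S$-integers in a number field $K$ ($S$ a finite set of places containing the infinite ones) and let $\ell$ be a prime. Assume that $\mathcal{O}_{K,S}$ is a principal ideal domain and that $\mathcal{O}_{K,S}[\zeta_\ell]$ is a Dedekind domain. Then the isomorphism classes of finitely generated $\mathcal{O}_{K,S}$-free $\mathcal{O}_{K,S}[\mathrm{C}_\ell]$-modules $M$ for which $M_{\mathrm{N}}:=\{m\in M\mid\mathrm{N}\cdot m=0\}$ has $\mathcal{O}_{K,S}[\zeta_\ell]$-rank $1$ are parametrized by (i.e. classified up to isomorphism by the values of) the following data: (1) the ideal class of the $\mathcal{O}_{K,S}[\zeta_\ell]$-module $M_{\mathrm{N}}$; (2) the $\mathcal{O}_{K,S}$-rank of $M/M_{\mathrm{N}}$; (3) an $\mathcal{O}_{K,S}[\zeta_\ell]^\times$-orbit of elements in $\mathcal{O}_{K,S}[\zeta_\ell]/(\zeta_\ell-1)$ (for the natural multiplication action). Any integer $n\ge 0$ is possible in (2), any ideal class is possible in (1), and any choice of orbit is possible in (3).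
   Context: $\mathrm{C}_\ell$ is the cyclic group of order $\ell$ with a chosen generator $\gamma$, $\zeta_\ell$ a primitive $\ell$-th root of unity, $\Phi_\ell$ the $\ell$-th cyclotomic polynomial (not assumed irreducible over $K$), and $\mathrm{N}=\sum_{g\in\mathrm{C}_\ell}[g]$ is the norm element. $M_{\mathrm{N}}$ is a module over $\mathcal{O}_{K,S}[\mathrm{C}_\ell]/(\mathrm{N})\cong\mathcal{O}_{K,S}[T]/(\Phi_\ell(T))$. That it has $\mathcal{O}_{K,S}[\zeta_\ell]$-rank 1 means that base change to $K$ gives one of the irreducible $K$-representations of $\mathrm{C}_\ell$, of underlying space $K(\zeta_\ell)$; the module structure then factors through a projection $\mathcal{O}_{K,S}[T]/(\Phi_\ell(T))\twoheadrightarrow\mathcal{O}_{K,S}[\zeta_\ell]$ and $M_{\mathrm{N}}$ is isomorphic to a fractional ideal $\mathfrak{a}$ of $\mathcal{O}_{K,S}[\zeta_\ell]$, whose class is the datum (1). The datum (3) is attached to $M$ as follows: choose an $\mathcal{O}_{K,S}$-module complement $X$ of $M_{\mathrm{N}}$ in $M$; the map $\gamma-1\colon X\to M_{\mathrm{N}}$, taken modulo $(\zeta_\ell-1)M_{\mathrm{N}}$, is, in suitable bases $y_1,y_2,\dots$ of $X$ modulo $\ell$ and $\beta$ of $M_{\mathrm{N}}/(\zeta_\ell-1)M_{\mathrm{N}}\cong\mathcal{O}_{K,S}[\zeta_\ell]/(\zeta_\ell-1)$, of the form $y_1\mapsto c\beta$, $y_j\mapsto 0$ for $j>1$; the datum (3)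 is the orbit of $c$.
   Formalization: Datum (1) includes the projection to O[ζ]. The O[ζ]^×-orbit in (3) is proved unique only for rank n=1; for n≥2 only its orbit under units of O[ζ]/(ζ−1) is, and for n=0 (3) is vacuous, as the claim fails there (e.g. ℓ=2, K=Q(√−11), n=2). *)

(* Defs.v *)
From HB Require Import structures.
From mathcomp Require Import all_boot all_order all_fingroup all_algebra all_solvable.
From mathcomp Require Import all_field.

Set Implicit Arguments.
Unset Strict Implicit.
Unset Printing Implicit Defensive.

Import Order.TTheory GRing.Theory Num.Theory.
Local Open Scope ring_scope.

(** * Rings *)

Definition is_ideal (R : idomainType) (I : R -> Prop) : Prop :=
  [/\ I 0, forall x y, I x -> I y -> I (x + y) & forall r x, I x -> I (r * x)].

Definition is_pid (R : idomainType) : Prop :=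
  forall I : R -> Prop, is_ideal I ->
    exists d : R, forall x, I x <-> exists r, x = r * d.

Definition is_noetherian (R : idomainType) : Prop :=
  forall I : R -> Prop, is_ideal I ->
    exists n (e : 'I_n -> R),
      forall x, I x <-> exists r : 'I_n -> R, x = \sum_i r i * e i.

Definition is_integrally_closed (R : idomainType) : Prop :=
  forall x : {fraction R},
    integralOver (@tofrac R) x -> exists r : R, x = tofrac r.

Definition is_prime_ideal (R : idomainType) (P : R -> Prop) : Prop :=
  [/\ is_ideal P, ~ P 1 & forall x y, P (x * y) -> P x \/ P y].

Definition is_maximal_ideal (R : idomainType) (P : R -> Prop) : Prop :=
  [/\ is_ideal P, ~ P 1 &
      forall J : R -> Prop, is_ideal J -> (forall x, P x -> J x) ->
        J 1 \/ (forall x, J x -> P x)].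

(* Fields are counted as Dedekind domains. *)
Definition is_dedekind (R : idomainType) : Prop :=
  [/\ is_noetherian R, is_integrally_closed R &
      forall P : R -> Prop, is_prime_ideal P -> (exists2 x, P x & x != 0) ->
        is_maximal_ideal P].

(** * S-integers *)

(* A finite place of a number field is given by its normalized discrete
   valuation; the value at 0, which should be +oo, is left unspecified. *)
Record finite_place (K : fieldType) := FinitePlace {
  place_val :> K -> int;
  place_valM : forall x y, x != 0 -> y != 0 ->
    place_val (x * y) = place_val x + place_val y;
  place_valD : forall x y, x != 0 -> y != 0 -> x + y != 0 ->
    Num.min (place_val x) (place_val y) <= place_val (x + y);
  place_val_normalized : exists2 x, x != 0 & place_val x = 1
}.

Definition same_place (K : fieldType) (v w : finite_place K) : Prop :=
  forall x, x != 0 -> v x = w x.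

(* Infinite places belong to S and impose no condition, so only the finite
   members S_0, ..., S_(s-1) of S are recorded. *)
Definition is_S_integer (K : fieldType) s (S : 'I_s -> finite_place K) (x : K)
    : Prop :=
  x != 0 -> forall v : finite_place K, ~ (exists i, same_place v (S i)) ->
    0 <= v x.

Definition is_S_integer_ring (K : fieldType) s (S : 'I_s -> finite_place K)
    (O : idomainType) (iO : {rmorphism O -> K}) : Prop :=
  injective iO /\ forall x, (exists o, iO o = x) <-> is_S_integer S x.

(* R, embedded in L by iR, is the subring O[z] of L. *)
Definition is_adjunction (K : fieldType) (L : fieldExtType K)
    (O : idomainType) (iO : {rmorphism O -> K}) (z : L)
    (R : idomainType) (iR : {rmorphism R -> L}) : Prop :=
  injective iR /\
  forall x, (exists r, iR r = x) <->
    exists p : {poly O}, x = (map_poly (fun o => (iO o)%:A) p).[z].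

(** * Fractional ideals of R in its fraction field L *)

Definition is_fractional_ideal (L : fieldType) (R : idomainType)
    (iR : {rmorphism R -> L}) (a : L -> Prop) : Prop :=
  [/\ exists2 x, a x & x != 0,
      forall x y, a x -> a y -> a (x + y),
      forall r x, a x -> a (iR r * x) &
      exists2 d : R, d != 0 & forall x, a x -> exists r, iR d * x = iR r].

Definition same_ideal_class (L : fieldType) (a a' : L -> Prop) : Prop :=
  exists2 t : L, t != 0 & forall x, a' (t * x) <-> a x.

(* r = r' in R/(z-1) *)
Definition eq_mod_z1 (L : fieldType) (R : idomainType) (iR : {rmorphism R -> L})
    (z : L) (r r' : R) : Prop :=
  exists t : R, iR r - iR r' = (z - 1) * iR t.

(* b is a basis of the R/(z-1)-module a/(z-1)a *)
Definition is_basis_mod_z1 (L : fieldType) (R : idomainType)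
    (iR : {rmorphism R -> L}) (z : L) (a : L -> Prop) (b : L) : Prop :=
  [/\ a b,
      forall x, a x -> exists (r : R) (t : L), a t /\ x = iR r * b + (z - 1) * t &
      forall r t, a t -> iR r * b = (z - 1) * t -> eq_mod_z1 iR z r 0].

(* r and r', as elements of R/(z-1), lie in the same orbit under R^x *)
Definition same_orbit (L : fieldType) (R : idomainType)
    (iR : {rmorphism R -> L}) (z : L) (r r' : R) : Prop :=
  exists2 u : R, u \is a GRing.unit & eq_mod_z1 iR z r' (u * r).

(* r and r', as elements of R/(z-1), lie in the same orbit under (R/(z-1))^x *)
Definition same_residue_orbit (L : fieldType) (R : idomainType)
    (iR : {rmorphism R -> L}) (z : L) (r r' : R) : Prop :=
  exists u v : R, eq_mod_z1 iR z (u * v) 1 /\ eq_mod_z1 iR z r' (u * r).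

(** * Modules over the group ring O[C], for a finite group C *)

Record gmodule (O : nzRingType) (C : finGroupType) := GModule {
  gm_car :> lmodType O;
  gm_act : C -> {linear gm_car -> gm_car};
  gm_act1 : forall m, gm_act 1%g m = m;
  gm_actM : forall h k m, gm_act (h * k)%g m = gm_act h (gm_act k m)
}.
Arguments gm_act {O C M} h : rename.

Definition gm_iso (O : nzRingType) (C : finGroupType) (M M' : gmodule O C)
    : Prop :=
  exists2 f : {linear M -> M'}, bijective f &
    forall h m, f (gm_act h m) = gm_act h (f m).

Definition is_submodule (O : nzRingType) (M : lmodType O) (X : M -> Prop)
    : Prop :=
  [/\ X 0, forall x y, X x -> X y -> X (x + y) & forall o x, X x -> X (o *: x)].

Definition is_basis (O : nzRingType) (M : lmodType O) (X : M -> Prop)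
    n (y : 'I_n -> M) : Prop :=
  (forall j, X (y j)) /\
  forall m, X m -> exists! c : 'rV[O]_n, m = \sum_j c 0 j *: y j.

Definition is_fg_free (O : nzRingType) (M : lmodType O) : Prop :=
  exists n (y : 'I_n -> M), is_basis (fun _ => True) y.

(* M/W is free of rank n *)
Definition quotient_has_rank (O : nzRingType) (M : lmodType O) (W : M -> Prop)
    (n : nat) : Prop :=
  exists y : 'I_n -> M,
    forall m, exists! c : 'rV[O]_n, W (m - \sum_j c 0 j *: y j).

Definition is_complement (O : nzRingType) (M : lmodType O) (W X : M -> Prop)
    : Prop :=
  [/\ is_submodule X, forall m, W m -> X m -> m = 0 &
      forall m, exists x w, [/\ X x, W w & m = x + w]].

(* The submodule M_N of elements killed by the norm element. *)
Definition norm_kernel (O : nzRingType) (C : finGroupType) (M : gmodule O C)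
    (m : M) : Prop :=
  \sum_(h : C) gm_act h m = 0.
Arguments norm_kernel {O C} M m.

(* phi embeds M_N O-linearly in L, the generator g of C acting as
   multiplication by w; values of phi outside M_N are irrelevant. For a root
   w of the l-th cyclotomic polynomial in L, this makes M_N a module over O[w],
   through the projection O[T]/Phi_l -> O[w] mapping T to w. *)
Definition norm_kernel_embedding (K : fieldType) (L : fieldExtType K)
    (O : idomainType) (iO : {rmorphism O -> K}) (C : finGroupType) (g : C)
    (w : L) (M : gmodule O C) (phi : M -> L) : Prop :=
  [/\ forall m m', norm_kernel M m -> norm_kernel M m' ->
        phi (m + m') = phi m + phi m',
      forall o m, norm_kernel M m -> phi (o *: m) = iO o *: phi m,
      forall m, norm_kernel M m -> phi (gm_act g m) = w * phi m &
      forall m, norm_kernel M m -> phi m = 0 -> m = 0].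

(* M_N has O[z]-rank 1: phi exhibits L = K(z), with g acting as some primitive
   l-th root of unity w, as the base change of M_N from O to its fraction
   field K. *)
Definition norm_kernel_rank1 (K : fieldType) (L : fieldExtType K)
    (O : idomainType) (iO : {rmorphism O -> K}) (l : nat)
    (C : finGroupType) (g : C) (M : gmodule O C) : Prop :=
  exists (w : L) (phi : M -> L),
    [/\ l.-primitive_root w, norm_kernel_embedding iO g w phi &
        forall x, exists (o : O) (m : M),
          [/\ o != 0, norm_kernel M m & iO o *: x = phi m]].

(** * The data attached to a module *)

(* phi is an isomorphism of O[w]-modules from M_N to the fractional ideal a. *)
Definition norm_kernel_iso (K : fieldType) (L : fieldExtType K)
    (O : idomainType) (iO : {rmorphism O -> K}) (C : finGroupType) (g : C)
    (w : L) (M : gmodule O C) (a : L -> Prop) (phi : M -> L) : Prop :=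
  norm_kernel_embedding iO g w phi /\
  forall x, a x <-> exists2 m, norm_kernel M m & phi m = x.

Definition has_ideal (K : fieldType) (L : fieldExtType K)
    (O : idomainType) (iO : {rmorphism O -> K}) (C : finGroupType) (g : C)
    (w : L) (M : gmodule O C) (a : L -> Prop) : Prop :=
  exists phi : M -> L, norm_kernel_iso iO g w a phi.

(* The orbit of c is a value of the third datum. The basis of M_N/(z-1)M_N
   is the one transported from a fixed basis b of a/(z-1)a; it cannot be chosen
   freely, as this would scale c by units of R/(z-1) that need not lift to
   units of R. For the same reason the basis of X modulo l is the reduction of
   an O-basis y of X. If n = 0 then X = 0, and the condition on y is empty. *)
Definition has_orbit (K : fieldType) (L : fieldExtType K)
    (O : idomainType) (iO : {rmorphism O -> K}) (z : L)
    (R : idomainType) (iR : {rmorphism R -> L}) (C : finGroupType) (g : C)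
    (w : L) (M : gmodule O C) (a : L -> Prop) (b : L) (n : nat) (c : R) : Prop :=
  exists (phi : M -> L) (X : M -> Prop) (y : 'I_n -> M) (c0 : R),
    [/\ norm_kernel_iso iO g w a phi,
        is_complement (norm_kernel M) X,
        is_basis X y,
        same_orbit iR z c c0 &
        forall j : 'I_n, exists2 t, a t &
          phi (gm_act g (y j) - y j) =
            (if j == 0%N :> nat then iR c0 * b else 0) + (z - 1) * t].

Definition has_data (K : fieldType) (L : fieldExtType K)
    (O : idomainType) (iO : {rmorphism O -> K}) (z : L)
    (R : idomainType) (iR : {rmorphism R -> L}) (C : finGroupType) (g : C)
    (w : L) (M : gmodule O C) (a : L -> Prop) (b : L) (n : nat) (c : R) : Prop :=
  [/\ has_ideal iO g w M a,
      quotient_has_rank (norm_kernel M) n &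
      has_orbit iO z iR g w M a b n c].

(* Main.v *)
(* Write M = M_N + X with X free over O. Multiplication by g - 1 sends X into
   M_N, and M is determined by M_N and by this map modulo (g - 1)M_N: changing X
   within M changes it by elements of (g - 1)M_N. A fractional ideal a = M_N is
   cyclic modulo z - 1, R/(z-1) is a quotient of O/l, and elimination over the
   principal ideal domain O turns the map into y_1 |-> c b, y_j |-> 0. Only
   multiplications by units of R and changes of basis of X remain. For rank > 1
   the latter multiply c by units modulo l, because O/l has stable range 1. *)

Require Import Defs.
From HB Require Import structures.
From mathcomp Require Import all_boot all_order all_fingroup all_algebra all_solvable.
From mathcomp Require Import all_field.
From mathcomp Require Import boolp ring zify.

Set Implicit Arguments.
Unset Strict Implicit.
Unset Printing Implicit Defensive.

Import Order.TTheory GRing.Theory Num.Theory.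
Local Open Scope ring_scope.

(** * Invertibility of ideals in Dedekind domains *)

(** Neither O/l nor R/(z-1) need be local, so cyclicity of a/(z-1)a is not immediate. It comes from
    two facts. A nonzero ideal a of the Dedekind domain R satisfies a a^-1 = R. And over the
    principal ideal domain O, for m != 0, some form p + x q takes on a submodule of O^2 containing m
    O^2 every value that either coordinate takes. Together they produce a single product y x = 1
    modulo z - 1, with x in a and y in a^-1. The first fact also shows that the multipliers of a are
    exactly R. Hence two isomorphisms of M_N with a differ by a true unit of R, which is why for
    rank 1 the orbit is one under R^x and not under the units of the residue ring. As Phi_l may be
    reducible over K, the generator acts on M_N by a primitive root w that need not be conjugate to
    z. Congruences are still taken modulo z - 1, because w - 1 and z - 1 generate the same ideal of
    R. *)

Section IdealTheory.
Variable R : idomainType.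
Implicit Types (I J H P T : R -> Prop) (x y a b c d : R).

Lemma ideal_sum I n (F : 'I_n -> R) :
  is_ideal I -> (forall i, I (F i)) -> I (\sum_i F i).
Proof. by case=> I0 ID _ hF; elim/big_ind: _ => // i _; apply: hF. Qed.

Definition principal x y := exists r : R, y = r * x.

Lemma principal_ideal x : is_ideal (principal x).
Proof.
split; first by exists 0; rewrite mul0r.
- by move=> _ _ [r ->] [s ->]; exists (r + s); rewrite mulrDl.
- by move=> t _ [r ->]; exists (t * r); rewrite mulrA.
Qed.

Definition colon I y x := I (x * y).

Lemma colon_ideal I y : is_ideal I -> is_ideal (colon I y).
Proof.
case=> I0 ID IM; split; rewrite /colon.
- by rewrite mul0r.
- by move=> a b ha hb; rewrite mulrDl; apply: ID.
- by move=> r a ha; rewrite -mulrA; apply: IM.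
Qed.

(** If no member of F were maximal, choice would give a strictly increasing sequence [u] of members.
    Its union is an ideal whose finitely many generators lie in one [u m], so [u m.+1] could add
    nothing. *)
Lemma noetherian_maximal (F : (R -> Prop) -> Prop) I0 :
  is_noetherian R -> (forall I, F I -> is_ideal I) -> F I0 ->
  exists I, F I /\
    forall J, F J -> (forall x, I x -> J x) -> forall x, J x -> I x.
Proof.
move=> hn hF hI0; apply: contrapT => hno.
have step (I : {I | F I}) : exists J : {J | F J},
    (forall x, sval I x -> sval J x) /\ exists x, sval J x /\ ~ sval I x.
  apply: contrapT => hJ; apply: hno; exists (sval I); split; first exact: svalP.
  move=> J FJ IJ x Jx; apply: contrapT => nIx; apply: hJ.
  by exists (exist _ J FJ); split=> //; exists x.
have [f hf] := choice step.
pose u k := iter k f (exist _ I0 hI0).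
have mono i j x : (i <= j)%N -> sval (u i) x -> sval (u j) x.
  move/subnK <-; elim: (j - i)%N => //= k IH hx.
  by apply: (proj1 (hf _)); apply: IH.
have uid k : is_ideal (sval (u k)) by apply: hF; apply: svalP.
have Uid : is_ideal (fun x => exists k, sval (u k) x).
  split.
  - by exists 0%N; case: (uid 0%N).
  - move=> x y [i hx] [j hy]; exists (maxn i j); case: (uid (maxn i j)) => _ D _.
    by apply: D; [apply: mono hx; apply: leq_maxl | apply: mono hy; apply: leq_maxr].
  - by move=> r x [i hx]; exists i; case: (uid i) => _ _; apply.
have [n [e he]] := hn _ Uid.
have ek i : exists k, sval (u k) (e i).
  by apply/he; exists (fun j => (j == i)%:R); rewrite (bigD1 i) //= eqxx mul1r big1
    ?addr0 // => j /negbTE ->; rewrite mul0r.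
have [k hk] := choice ek.
pose m := \max_i k i.
have [x [hx nx]] := proj2 (hf (u m)).
apply: nx; have /he [r ->] : exists j, sval (u j) x by exists m.+1.
apply: ideal_sum => // i; case: (uid m) => _ _; apply.
by apply: mono (hk i); apply: leq_bigmax.
Qed.

(* The multiplication by a/d on I has a matrix, and a/d is a root of its
   characteristic polynomial. *)
Lemma integrally_closed_dvd I x a d :
  is_noetherian R -> is_integrally_closed R -> is_ideal I -> I x -> x != 0 ->
  d != 0 -> (forall y, I y -> exists2 y', I y' & a * y = d * y') ->
  principal d a.
Proof.
move=> hn hic hI Ix x0 d0 hst.
have [n [e he]] := hn _ hI.
have Ie i : I (e i).
  apply/he; exists (fun j => (j == i)%:R); rewrite (bigD1 i) //= eqxx mul1r big1
    ?addr0 // => j /negbTE ->; by rewrite mul0r.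
have hA i : exists r : 'I_n -> R, a * e i = d * \sum_j r j * e j.
  by have [y /he [r ->] ->] := hst _ (Ie i); exists r.
have [A hA'] := choice hA.
pose F := {fraction R}.
pose v : 'rV[F]_n := \row_j tofrac (e j).
pose B : 'M[F]_n := map_mx (@tofrac R) (\matrix_(i, j) A j i).
have td : tofrac d != 0 :> F by rewrite tofrac_eq0.
pose q : F := tofrac a / tofrac d.
have vB : v *m B = q *: v.
  apply/rowP=> j; rewrite !mxE; apply: (mulfI td).
  rewrite /q mulrA mulrCA mulfV // mulr1 -[RHS]tofracM hA' tofracM rmorph_sum /=.
  congr (_ * _); apply: eq_bigr => i _; by rewrite !mxE -tofracM mulrC.
have v0 : v != 0.
  apply: contraNneq x0 => v0; case/he: Ix => r ->; apply/eqP.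
  apply: big1 => i _; move/rowP/(_ i): v0; rewrite !mxE => /eqP.
  by rewrite tofrac_eq0 => /eqP ->; rewrite mulr0.
have : root (char_poly B) q.
  by rewrite -eigenvalue_root_char; apply/eigenvalueP; exists v.
rewrite /B -map_char_poly => hr.
have [|r hr'] := hic q; first by exists (char_poly (\matrix_(i, j) A j i)) => //;
  apply: char_poly_monic.
exists r; apply/eqP; rewrite -tofrac_eq tofracM -hr' /q divfK //.
Qed.

(* An ideal (x : y) maximal among those contained in a maximal ideal P of R is
   prime, hence equal to P. *)
Lemma dedekind_colon H x :
  is_dedekind R -> is_ideal H -> ~ H 1 -> H x -> x != 0 ->
  exists y, (forall h, H h -> principal x (h * y)) /\ ~ principal x y.
Proof.
case=> hn _ hdim hH H1 Hx x0.
have [P [[hP P1 HP] Pmax]] := @noetherian_maximal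
  (fun I => [/\ is_ideal I, ~ I 1 & forall h, H h -> I h]) H hn
  (fun I h => let: And3 h _ _ := h in h) (And3 hH H1 (fun _ => id)).
pose F I := exists y, (forall r, I r <-> principal x (r * y)) /\
  (forall r, I r -> P r).
have FI I : F I -> is_ideal I.
  case=> y [hy _]; have [c0 cD cM] := colon_ideal y (principal_ideal x).
  split; first exact/hy.
  - by move=> r s /hy hr /hy hs; apply/hy; apply: cD.
  - by move=> r s /hy hs; apply/hy; apply: cM.
have F0 : F (principal x).
  exists 1; split=> [r|r [s ->]]; first by rewrite mulr1.
  by case: hP => _ _; apply; apply: HP.
have [Q [FQ Qmax]] := noetherian_maximal hn FI F0.
case: (FQ) => y [hy QP]; have Qid := FI _ FQ.
have Qx : Q x by apply/hy; exists y; rewrite mulrC.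
have Pprime r s : P (r * s) -> ~ P s -> P r.
  move=> hrs hs; have [P0 PD PM] := hP.
  pose T t := exists u v, P u /\ t = u + v * s.
  have [u [v [Pu e1]]] : T 1.
    apply: contrapT => T1; apply: hs; apply: (Pmax T); last first.
    - by exists 0, 1; rewrite add0r mul1r.
    - by move=> t Pt; exists t, 0; rewrite mul0r addr0.
    split=> // [|h Hh]; last by exists h, 0; rewrite mul0r addr0; split=> //; apply: HP.
    split.
    - by exists 0, 0; rewrite mul0r addr0.
    - move=> _ _ [u [v [Pu ->]]] [u' [v' [Pu' ->]]]; exists (u + u'), (v + v').
      by rewrite mulrDl addrACA; split=> //; apply: PD.
    - move=> t _ [u [v [Pu ->]]]; exists (t * u), (t * v).
      by rewrite mulrDr mulrA; split=> //; apply: PM.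
  by rewrite -[r]mulr1 e1 mulrDr mulrCA; apply: PD; apply: PM.
(* (Q : s) equals (x : s y), so it belongs to F as soon as it lies in P, and maximality of Q then
   gives (Q : s) = Q. *)
have Q_colon s : (forall r, Q (r * s) -> P r) -> forall r, Q (r * s) -> Q r.
  move=> sP; apply: (Qmax (colon Q s)) => [|r Qr].
    exists (s * y); split=> r; last exact: sP.
    by rewrite /colon hy mulrA.
  by rewrite /colon mulrC; case: Qid => _ _; apply.
have Qprime : is_prime_ideal Q.
  split=> // [Q1|a b Qab]; first by apply: P1; apply: QP.
  (* Either a is in (Q : s) for some s outside P, and primality of P puts (Q : s) inside P; or no
     such s exists, which says that (Q : a), which contains b, lies in P. *)
  have [[s nPs Qsa]|nsa] := pselect (exists2 s, ~ P s & Q (s * a)).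
    left; apply: (Q_colon s) => [r /QP /Pprime|]; first exact.
    by rewrite mulrC.
  right; apply: (Q_colon a); last by rewrite mulrC.
  by move=> r Qra; apply: contrapT => nPr; apply: nsa; exists r.
(* Dimension at most one makes the nonzero prime Q maximal, so Q = P contains H; and y is not a
   multiple of x because 1 is not in Q. *)
have [//|_ _ Q_max] := hdim Q Qprime; first by exists x.
have [//|PQ] := Q_max P hP QP.
exists y; split=> [h /HP /PQ /hy //|[r hr]].
by apply: P1; apply: QP; apply/hy; exists r; rewrite mul1r.
Qed.

(* With J the colon ideal (c) : I, were c^-1 I J proper it would be killed
   modulo c by a y not divisible by c, so y/c would map J to itself. *)
Lemma dedekind_invertible I T c :
  is_dedekind R -> is_ideal I -> I c -> c != 0 -> is_ideal T ->
  (forall a b r, I a -> (forall a', I a' -> principal c (a' * b)) ->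
     a * b = r * c -> T r) ->
  T 1.
Proof.
move=> hR hI Ic c0 hT hIJ; apply: contrapT => T1.
have [hn hic _] := hR; have [I0 ID IM] := hI.
pose J b := forall a, I a -> principal c (a * b).
have J_id : is_ideal J.
  split.
  - by move=> a _; exists 0; rewrite mulr0 mul0r.
  - move=> b b' hb hb' a Ia; have [s hs] := hb _ Ia; have [s' hs'] := hb' _ Ia.
    by exists (s + s'); rewrite mulrDr hs hs' mulrDl.
  - move=> t b hb a Ia; have [s hs] := hb _ Ia.
    by exists (t * s); rewrite mulrCA hs mulrA.
have Jc : J c by move=> a _; exists a.
have Tc : T c by apply: (hIJ c c).
have [y [yT ny]] := dedekind_colon hR hT T1 Tc c0.
apply: ny; apply: (@integrally_closed_dvd J c) => // b Jb.
(* The choice a = c shows that J lies in T, hence y b = s c. This s is again in J: a b = r c with r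
   in T gives a s = r y, a multiple of c. *)
have [s hs] := yT _ (hIJ c b b Ic Jb (mulrC _ _)).
exists s; last by rewrite mulrC hs mulrC.
move=> a Ia; have [r hr] := Jb _ Ia.
have [q hq] := yT _ (hIJ a b r Ia Jb hr).
exists q; apply: (mulIf c0); rewrite -mulrA -hs mulrA hr mulrAC hq.
by rewrite mulrAC.
Qed.

End IdealTheory.

(** * Stable range 1 for quotients of principal ideal domains *)

Section PID.
Variables (O : idomainType) (hO : is_pid O).
Implicit Types (x y z d e f m p q r : O).

Lemma pid_bezout x y : exists d x' y' u v,
  [/\ x = x' * d, y = y' * d & d = u * x + v * y].
Proof.
have hI : is_ideal (fun t => exists u v, t = u * x + v * y).
  split; first by exists 0, 0; rewrite !mul0r addr0.
  - move=> _ _ [u [v ->]] [u' [v' ->]]; exists (u + u'), (v + v').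
    by rewrite !mulrDl addrACA.
  - by move=> r _ [u [v ->]]; exists (r * u), (r * v); rewrite mulrDr !mulrA.
have [d hd] := hO hI.
have [x' hx] : exists r, x = r * d.
  by apply/hd; exists 1, 0; rewrite mul1r mul0r addr0.
have [y' hy] : exists r, y = r * d.
  by apply/hd; exists 0, 1; rewrite mul1r mul0r add0r.
have /hd [u [v hdd]] : exists r, d = r * d by exists 1; rewrite mul1r.
by exists d, x', y', u, v.
Qed.

Definition coprime_elt x y := exists u v, u * x + v * y = 1.

Lemma coprime_of_divisors x y : x != 0 ->
  (forall f x' y', x = x' * f -> y = y' * f -> f \is a GRing.unit) ->
  coprime_elt x y.
Proof.
move=> x0 hf; have [d [x' [y' [u [v [hx hy hd]]]]]] := pid_bezout x y.
have ud : d \is a GRing.unit by apply: hf hx hy.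
by exists (d^-1 * u), (d^-1 * v); rewrite -!mulrA -mulrDr -hd mulVr.
Qed.

Lemma coprime_divisor x y f x' y' :
  coprime_elt x y -> x = x' * f -> y = y' * f -> f \is a GRing.unit.
Proof.
case=> u [v h] hx hy; apply/unitrPr; exists (u * x' + v * y').
by rewrite mulrDr -h hx hy !(mulrC f) !mulrA.
Qed.

Lemma coprime_dvd x y z r : coprime_elt x y -> z * y = r * x -> exists s, z = s * x.
Proof.
case=> u [v h] hz; exists (z * u + v * r).
by rewrite -[LHS]mulr1 -h mulrDr mulrDl -!mulrA -hz; congr (_ + _); rewrite mulrCA.
Qed.

(* x generates the ideal (m : y^oo). *)
Lemma coprime_part m y : m != 0 -> exists x k q r,
  [/\ x * y ^+ k = q * m, m = r * x, x != 0 & coprime_elt x y].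
Proof.
move=> m0.
have hI : is_ideal (fun t => exists k q, t * y ^+ k = q * m).
  split; first by exists 0%N, 0; rewrite !mul0r.
  - move=> s t [k [q hs]] [k' [q' ht]]; exists (k + k')%N.
    exists (q * y ^+ k' + q' * y ^+ k); rewrite mulrDl !mulrDl exprD mulrA hs.
    by rewrite [y ^+ k * _]mulrC mulrA ht !(mulrAC _ m).
  - by move=> r s [k [q hs]]; exists k, (r * q); rewrite -mulrA hs mulrA.
have [x hx] := hO hI.
have [k [q hxq]] : exists k q, x * y ^+ k = q * m.
  by apply/hx; exists 1; rewrite mul1r.
have [r hr] : exists r, m = r * x.
  by apply/hx; exists 0%N, 1; rewrite mulr1 mul1r.
have x0 : x != 0 by apply: contraNneq m0 => x0; rewrite hr x0 mulr0.
exists x, k, q, r; split=> //; apply: coprime_of_divisors => // f x' y' ex ey.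
(* As f divides y too, x' y^(k+1) is a multiple of m. So x' lies in the ideal generated by x, and x
   = x' f = s x f makes f a unit. *)
have [s hs] : exists s, x' = s * x.
  apply/hx; exists k.+1, (y' * q).
  by rewrite -mulrA -hxq exprS {1}ey ex; ring.
apply/unitrPr; exists s; apply: (mulIf x0).
by rewrite mul1r [RHS]ex hs; ring.
Qed.

Lemma coprime_dvd_exp x y z k r :
  coprime_elt x y -> z * y ^+ k = r * x -> exists s, z = s * x.
Proof.
move=> hxy; elim: k r => [|k IH] r; first by rewrite mulr1; exists r.
by rewrite exprSr mulrA => /(coprime_dvd hxy) [s]; apply: IH.
Qed.

(* Modulo m, the generator d of the sum of both projections of P becomes p + x q
   as soon as x is the largest divisor of m/d prime to d1/d, where d1 generates
   the first projection: this is stable range 1 for O/m. *)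
Lemma pid_stable_range (P : O -> O -> Prop) m :
  m != 0 -> P m 0 -> P 0 m ->
  (forall p q p' q', P p q -> P p' q' -> P (p + p') (q + q')) ->
  (forall r p q, P p q -> P (r * p) (r * q)) ->
  exists x, forall p q, P p q ->
    (exists p' q', P p' q' /\ p = p' + x * q') /\
    (exists p' q', P p' q' /\ q = p' + x * q').
Proof.
move=> m0 Pm1 Pm2 PD PM.
have P00 : P 0 0 by move/(PM 0): Pm1; rewrite !mul0r.
have [d1 h1] : exists d, forall p, (exists q, P p q) <-> exists r, p = r * d.
  apply: hO; split; first by exists 0.
  - by move=> p p' [q hq] [q' hq']; exists (q + q'); apply: PD.
  - by move=> r p [q hq]; exists (r * q); apply: PM.
have [d2 h2] : exists d, forall q, (exists p, P p q) <-> exists r, q = r * d.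
  apply: hO; split; first by exists 0.
  - by move=> q q' [p hp] [p' hp']; exists (p + p'); apply: PD.
  - by move=> r q [p hp]; exists (r * p); apply: PM.
have [d [d1' [d2' [u [v [e1 e2 ed]]]]]] := pid_bezout d1 d2.
have [m1 em1] : exists r, m = r * d1 by apply/h1; exists 0.
have d0 : d != 0 by apply: contraNneq m0 => d0; rewrite em1 e1 d0 !mulr0.
pose m' := m1 * d1'.
have em : m = m' * d by rewrite em1 e1 mulrA.
have m'0 : m' != 0 by apply: contraNneq m0 => h; rewrite em h mul0r.
have [x [k [q0 [r0 [hxk hxr _ hxd]]]]] := coprime_part d1' m'0.
exists x.
(* The values of p + x q on P. The aim is that the generator e of this ideal is d up to a unit, that
   is, that e' = e/d is a unit. *)
pose J t := exists p q, P p q /\ t = p + x * q.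
have JM r t : J t -> J (r * t).
  case=> p [q [hp ->]]; exists (r * p), (r * q); split; first exact: PM.
  by rewrite mulrDr mulrCA.
have [e he] : exists e, forall t, J t <-> exists r, t = r * e.
  apply: hO; split=> //; first by exists 0, 0; rewrite mulr0 addr0.
  move=> _ _ [p [q [hp ->]]] [p' [q' [hp' ->]]].
  exists (p + p'), (q + q'); split; first exact: PD.
  by rewrite mulrDr addrACA.
have [e' ee] : exists e', e = e' * d.
  have /he [p [q [hp ->]]] : exists r, e = r * e by exists 1; rewrite mul1r.
  have [c hc] : exists r, p = r * d1 by apply/h1; exists q.
  have [c' hc'] : exists r, q = r * d2 by apply/h2; exists p.
  by exists (c * d1' + x * (c' * d2')); rewrite hc hc' e1 e2; ring.
have [s hs] : exists s, m = s * e.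
  by apply/he; exists m, 0; rewrite mulr0 addr0.
have ems : m' = s * e' by apply: (mulIf d0); rewrite -em hs ee mulrA.
have e'0 : e' != 0 by apply: contraNneq m'0 => h; rewrite ems h mulr0.
have co12 : coprime_elt d1' d2'.
  by exists u, v; apply: (mulIf d0); rewrite mul1r [RHS]ed e1 e2; ring.
(* By evaluation at (p2, d2), a common divisor f of e' and d1' divides x d2'. It is prime to x, so
   it divides d2', which is prime to d1'. *)
have co : coprime_elt e' d1'.
  apply: coprime_of_divisors => // f x1 y1 ex ey.
  have [p2 hp2] : exists p, P p d2 by apply/h2; exists 1; rewrite mul1r.
  have [c hc] : exists r, p2 = r * d1 by apply/h1; exists d2.
  have [j hj] : exists j, p2 + x * d2 = j * e by apply/he; exists p2, d2.
  have hxd2 : x * d2' = (j * x1 - c * y1) * f.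
    apply: (mulIf d0); rewrite -mulrA -e2.
    have -> : x * d2 = j * e - p2 by rewrite -hj; ring.
    by rewrite hc e1 ee ex ey; ring.
  have [y2 hy2] : exists t, d2' = t * f.
    apply: (@coprime_dvd f x d2' (j * x1 - c * y1)); last by rewrite mulrC.
    by case: hxd => a [b hab]; exists (b * y1), a; rewrite -hab ey; ring.
  exact: coprime_divisor co12 ey hy2.
(* e' divides m', hence x d1'^k, and it is prime to d1', so it divides x. Evaluation at (d1, q1)
   then shows that e' divides d1' as well. *)
have [t ht] : exists t, x = t * e'.
  by apply: (coprime_dvd_exp co (k := k) (r := q0 * s)); rewrite hxk ems mulrA.
have [q1 hq1] : exists q, P d1 q by apply/h1; exists 1; rewrite mul1r.
have [c hc] : exists r, q1 = r * d2 by apply/h2; exists d1.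
have [j hj] : exists j, d1 + x * q1 = j * e by apply/he; exists d1, q1.
have hd1 : d1' = (j - t * c * d2') * e'.
  apply: (mulIf d0); rewrite -e1.
  have -> : d1 = j * e - x * q1 by rewrite -hj; ring.
  by rewrite ee hc e2 ht; ring.
have ue : e' \is a GRing.unit.
  by apply: (coprime_divisor co (x' := 1) (y' := j - t * c * d2')); rewrite ?mul1r.
have Jd r : J (r * d).
  by apply: JM; apply/he; exists e'^-1; rewrite ee mulKr.
move=> p q hpq; split.
  have [r ->] : exists r, p = r * d1 by apply/h1; exists q.
  by rewrite e1 mulrA; apply: Jd.
have [r ->] : exists r, q = r * d2 by apply/h2; exists p.
by rewrite e2 mulrA; apply: Jd.
Qed.

(* Applied to the submodule of the (x r + m s, (1 - x y) r + m t): it yields an s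
   with x + s (1 - x y) a unit modulo m, and x c = (x + s (1 - x y)) c as soon as
   (1 - x y) c = 0. *)
Lemma pid_unit_lift m x y : m != 0 ->
  exists s r t, (x + s * (1 - x * y)) * r = 1 + t * m.
Proof.
move=> m0.
pose P p q := exists r s t, p = x * r + m * s /\ q = (1 - x * y) * r + m * t.
have Pm1 : P m 0 by exists 0, 1, 0; split; ring.
have Pm2 : P 0 m by exists 0, 0, 1; split; ring.
have [||s hs] := pid_stable_range m0 Pm1 Pm2.
- move=> _ _ _ _ [r [s [t [-> ->]]]] [r' [s' [t' [-> ->]]]].
  by exists (r + r'), (s + s'), (t + t'); split; ring.
- move=> a _ _ [r [s [t [-> ->]]]].
  by exists (a * r), (a * s), (a * t); split; ring.
have [|[_ [_ [[r1 [s1 [t1 [-> ->]]]] e1]]] [_ [_ [[r2 [s2 [t2 [-> ->]]]] e2]]]] :=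
  hs x (1 - x * y); first by exists 1, 0, 0; split; ring.
(* P is generated by (x, 1 - x y) modulo m, and p + s q takes the value x + s (1 - x y) there.
   Adding y times the expression for x to the one for 1 - x y writes 1 as a multiple of this value
   modulo m. *)
exists s, (y * r1 + r2), (- (y * s1 + s2 + s * (y * t1 + t2))).
set R1 := (X in x = X) in e1; set R2 := (X in _ = X) in e2.
have e : y * x + (1 - x * y) = y * R1 + R2 by rewrite -e1 -e2.
apply/eqP; rewrite -subr_eq0; apply/eqP.
transitivity (y * R1 + R2 - (y * x + (1 - x * y))); last by rewrite e subrr.
by rewrite /R1 /R2; ring.
Qed.
End PID.

(** * Denominators of S-integers *)

Section Valuation.
Variables (K : fieldType) (v : finite_place K).

Definition val_ring (x : K) := x = 0 \/ 0 <= v x.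

Lemma place_val1 : v 1 = 0.
Proof.
have /eqP := place_valM v (oner_neq0 K) (oner_neq0 K).
by rewrite mulr1 -subr_eq0 opprD addNKr oppr_eq0 => /eqP.
Qed.

Lemma val_ringM x y : val_ring x -> val_ring y -> val_ring (x * y).
Proof.
have [->|x0] := eqVneq x 0; first by rewrite mul0r; left.
have [->|y0] := eqVneq y 0; first by rewrite mulr0; left.
case=> [/eqP|hx]; first by rewrite (negbTE x0).
case=> [/eqP|hy]; first by rewrite (negbTE y0).
by right; rewrite place_valM // addr_ge0.
Qed.

Lemma val_ringD x y : val_ring x -> val_ring y -> val_ring (x + y).
Proof.
have [->|x0] := eqVneq x 0; first by rewrite add0r.
have [->|y0] := eqVneq y 0; first by rewrite addr0.
case=> [/eqP|hx]; first by rewrite (negbTE x0).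
case=> [/eqP|hy]; first by rewrite (negbTE y0).
have [->|xy0] := eqVneq (x + y) 0; first by left.
by right; apply: le_trans (place_valD v x0 y0 xy0); rewrite le_min hx hy.
Qed.

Lemma val_ring1 : val_ring 1. Proof. by right; rewrite place_val1. Qed.

Lemma val_ringN1 : val_ring (-1).
Proof.
have n0 : -1 != 0 :> K by rewrite oppr_eq0 oner_eq0.
have /eqP := place_valM v n0 n0; rewrite mulrNN mulr1 place_val1 => h.
by right; move: h; case: (v (-1)) => n; lia.
Qed.

Lemma val_ring_int (n : int) : val_ring n%:~R.
Proof.
have hn (k : nat) : val_ring k%:R.
  elim: k => [|k IH]; first by left.
  by rewrite -natr1; apply: val_ringD => //; apply: val_ring1.
case: n => k; first exact: hn.
by rewrite NegzE mulrNz -mulN1r; apply: val_ringM (hn _); apply: val_ringN1.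
Qed.

Lemma val_ringX x n : val_ring x -> val_ring (x ^+ n).
Proof.
move=> hx; elim: n => [|n IH]; first exact: val_ring1.
by rewrite exprS; apply: val_ringM.
Qed.

Lemma val_ringV x : ~ val_ring x -> val_ring x^-1.
Proof.
move=> hx; have x0 : x != 0 by apply: contra_notN hx => /eqP ->; left.
right; have /eqP := place_valM v x0 (invr_neq0 x0).
rewrite mulfV // place_val1 => h; have : ~ 0 <= v x by move=> ?; apply: hx; right.
by move: h; lia.
Qed.

(* Were x not in the valuation ring, 1/x would be, and dividing the equation
   by x^(n-1) would express x as a polynomial in 1/x. *)
Lemma val_ring_integral n (q : 'I_n -> K) x :
  (forall i, val_ring (q i)) -> x ^+ n = \sum_i q i * x ^+ i -> val_ring x.
Proof.
move=> hq hx; apply: contrapT => nx; have hV := val_ringV nx.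
have x0 : x != 0 by apply: contra_notN nx => /eqP ->; left.
case: n q hq hx => [|n] q hq hx.
  move: hx; rewrite big_ord0 expr0 => /eqP; by rewrite oner_eq0.
apply: nx; have -> : x = \sum_i q i * (x^-1) ^+ (n - i).
  apply: (mulIf (expf_neq0 n x0)); rewrite -exprS hx mulr_suml.
  apply: eq_bigr => i _; rewrite -mulrA; congr (_ * _).
  have hi : (i <= n)%N by rewrite -ltnS.
  have -> : x ^+ n = x ^+ (n - i) * x ^+ i by rewrite -exprD subnK.
  by rewrite mulrA -exprMn mulVf // expr1n mul1r.
elim/big_ind: _; [by left | exact: val_ringD | move=> i _].
by apply: val_ringM => //; apply: val_ringX.
Qed.
End Valuation.

Lemma alg_rat_poly_int (K : fieldExtType rat) (x : K) :
  exists2 q : {poly int}, q != 0 & root (map_poly intr q) x.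
Proof.
have [p pmon] := alg_integral x.
have [q [a a0 hq]] := rat_poly_scale p; rewrite hq => hroot.
exists q; first by apply: contraTneq pmon => q0; rewrite hq q0 rmorph0 scaler0 monicE
  lead_coef0 eq_sym oner_eq0.
move: hroot; rewrite map_polyZ rootZ; last by rewrite fmorph_eq0 invr_eq0 intr_eq0.
rewrite -map_poly_comp /=; congr (root _ x).
by apply: eq_map_poly => c; rewrite -[LHS]/(in_alg K c%:~R) rmorph_int.
Qed.

(** The leading coefficient D of an integer polynomial vanishing at x makes D x integral over the
    integers, and valuation rings contain all such elements. One D thus serves all finite places. *)
Lemma val_ring_denominator (K : fieldExtType rat) (x : K) :
  exists2 D : int, D != 0 & forall v : finite_place K, val_ring v (D%:~R * x).
Proof.
have [q q0 hroot] := alg_rat_poly_int x.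
pose D := lead_coef q.
have D0 : D != 0 by rewrite lead_coef_eq0.
exists D => // v.
have [n size_q] : exists n, size q = n.+1.
  by case E: (size q) => [|n]; [move/eqP: E q0; rewrite size_poly_eq0 => -> | exists n].
have hD : D = q`_n by rewrite /D lead_coefE size_q.
have hsum : D%:~R * x ^+ n = - \sum_(i < n) (q`_i)%:~R * x ^+ i.
  move/rootP: hroot; rewrite horner_poly size_q big_ord_recr /= -hD => /eqP.
  by rewrite addrC addr_eq0 => /eqP.
case: n size_q hD hsum => [|n] size_q hD hsum.
  move: hsum; rewrite big_ord0 oppr0 mulr1 -[D%:~R](rmorph_int (in_alg K)) => /eqP.
  by rewrite fmorph_eq0 intr_eq0 (negbTE D0).
(* The equation of x multiplied by D^n is a monic equation in D x, of degree n + 1. *)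
apply: (@val_ring_integral _ v n.+1 (fun i => (- q`_i * D ^+ (n - i))%:~R)).
  by move=> i; apply: val_ring_int.
rewrite exprMn exprSr -mulrA hsum mulrN mulr_sumr -sumrN; apply: eq_bigr => i _.
have hi : (i <= n)%N by rewrite -ltnS.
rewrite -{1}(subnK hi) exprD !rmorphM rmorphXn rmorphN /= exprMn; ring.
Qed.

(** K is the fraction field of O: an integer denominator clears x at every finite place, so in
    particular at those outside S. *)
Lemma S_integer_fraction (K : fieldExtType rat) s (S : 'I_s -> finite_place K)
    (O : idomainType) (iO : {rmorphism O -> K}) (x : K) :
  is_S_integer_ring S iO -> exists o o', o != 0 /\ iO o * x = iO o'.
Proof.
case=> iO_inj hO; have [D D0 hD] := val_ring_denominator x.
have [o ho] : exists o, iO o = D%:~R * x.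
  by apply/hO => n0 v _; case: (hD v) => // /eqP; rewrite (negbTE n0).
exists D%:~R, o; rewrite rmorph_int; split=> //.
apply: contraNneq D0 => /(congr1 iO) /eqP.
by rewrite rmorph0 rmorph_int -(rmorph_int (in_alg K)) fmorph_eq0 intr_eq0.
Qed.

Lemma natr_S_integer_neq0 (K : fieldExtType rat) (O : idomainType)
    (iO : {rmorphism O -> K}) n : (0 < n)%N -> n%:R != 0 :> O.
Proof.
move=> n0; apply: contraTneq n0 => /(congr1 iO) /eqP.
rewrite rmorph0 rmorph_nat -(rmorph_nat (in_alg K)) fmorph_eq0 pnatr_eq0.
by move/eqP ->.
Qed.

(** * Submodules of free modules over principal ideal domains *)

Section Lincomb.
Variables (O : idomainType) (M : lmodType O).
Implicit Types (W X : M -> Prop) (m x : M).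

Definition lincomb n (y : 'I_n -> M) (c : 'rV[O]_n) := \sum_j c 0 j *: y j.

Lemma lincomb_is_linear n (y : 'I_n -> M) : linear (lincomb y).
Proof.
move=> o c c'; rewrite /lincomb scaler_sumr -big_split; apply: eq_bigr => j _ /=.
by rewrite !mxE scalerDl scalerA.
Qed.

HB.instance Definition _ n (y : 'I_n -> M) :=
  GRing.isLinear.Build O 'rV[O]_n M _ (lincomb y) (lincomb_is_linear y).

Lemma lincomb_delta n (y : 'I_n -> M) j : lincomb y (delta_mx 0 j) = y j.
Proof.
rewrite /lincomb (bigD1 j) //= mxE !eqxx scale1r big1 ?addr0 // => i /negbTE ij.
by rewrite mxE ij andbF scale0r.
Qed.

Lemma submoduleB W x y : is_submodule W -> W x -> W y -> W (x - y).
Proof. by case=> _ WD WZ Wx Wy; rewrite -scaleN1r; apply: WD => //; apply: WZ. Qed.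

Lemma submodule_sum W n (F : 'I_n -> M) :
  is_submodule W -> (forall i, W (F i)) -> W (\sum_i F i).
Proof. by case=> W0 WD _ hF; elim/big_ind: _. Qed.

Lemma lincomb_in W n (y : 'I_n -> M) c :
  is_submodule W -> (forall j, W (y j)) -> W (lincomb y c).
Proof.
by move=> hW Wy; apply: submodule_sum => // j; case: hW => _ _; apply.
Qed.

Lemma is_basis_intro W n (y : 'I_n -> M) :
  (forall j, W (y j)) -> (forall m, W m -> exists c, m = lincomb y c) ->
  (forall c, lincomb y c = 0 -> c = 0) -> is_basis W y.
Proof.
move=> Wy hs hf; split=> // m /hs [c ->]; exists c; split=> // c' /eqP.
by rewrite -[X in _ == X]/(lincomb y c') -subr_eq0 -linearB => /eqP /hf /eqP;
  rewrite subr_eq0 => /eqP.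
Qed.

Lemma is_basis_span W n (y : 'I_n -> M) m :
  is_basis W y -> W m -> exists c, m = lincomb y c.
Proof. by case=> _ h /h [c [hc _]]; exists c. Qed.

Lemma is_basis_free W n (y : 'I_n -> M) c :
  is_submodule W -> is_basis W y -> lincomb y c = 0 -> c = 0.
Proof.
case=> W0 _ _ [_ h] hc; have [c0 [_ hu]] := h _ W0.
by rewrite -(hu c) ?(hu 0) //; rewrite -/(lincomb _ _) ?hc // linear0.
Qed.

Lemma is_basis_unique W n (y : 'I_n -> M) c c' :
  is_submodule W -> is_basis W y -> lincomb y c = lincomb y c' -> c = c'.
Proof.
move=> hW hy /eqP; rewrite -subr_eq0 -linearB => /eqP /(is_basis_free hW hy) /eqP.
by rewrite subr_eq0 => /eqP.
Qed.

Hypothesis hpid : is_pid O.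

(** The ideal f(W) is generated by some d. If d = 0 the basis of the kernel is one of W; otherwise a
    preimage of d is prepended to it, which explains the special index 0. This serves both the
    freeness of submodules and the elimination on X. *)
Lemma rebase_along W (f : M -> O) n (y : 'I_n -> M) :
  is_submodule W ->
  (forall o x x', W x -> W x' -> f (o *: x + x') = o * f x + f x') ->
  is_basis (fun x => W x /\ f x = 0) y ->
  exists n' (y' : 'I_n' -> M),
    is_basis W y' /\ forall j : 'I_n', j != 0%N :> nat -> f (y' j) = 0.
Proof.
move=> hW fW hy; have [W0 WD WZ] := hW.
have f0 : f 0 = 0.
  by have := fW (-1) 0 0 W0 W0; rewrite scaler0 addr0 mulN1r addNr.
have fZ o x : W x -> f (o *: x) = o * f x.
  by move=> Wx; have := fW o x 0 Wx W0; rewrite !addr0 f0 addr0.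
have hker : is_submodule (fun x => W x /\ f x = 0).
  split=> // [x x' [Wx fx] [Wx' fx']|o x [Wx fx]].
    by split; [apply: WD | rewrite -[x]scale1r fW // fx fx' mulr0 addr0].
  by split; [apply: WZ | rewrite fZ // fx mulr0].
have [d hd] : exists d, forall t, (exists x, W x /\ f x = t) <-> exists r, t = r * d.
  apply: hpid; split; first by exists 0.
  - move=> _ _ [x [Wx <-]] [x' [Wx' <-]]; exists (1 *: x + x').
    by rewrite fW // mul1r scale1r; split=> //; apply: WD.
  - by move=> r _ [x [Wx <-]]; exists (r *: x); rewrite fZ //; split=> //; apply: WZ.
have [d0|d0] := eqVneq d 0.
  have fW0 x : W x -> f x = 0.
    move=> Wx; have [r ->] : exists r, f x = r * d by apply/hd; exists x.
    by rewrite d0 mulr0.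
  exists n, y; split; last by move=> j _; apply: (proj2 (proj1 hy j)).
  case: hy => hy1 hy2; split=> [j|m Wm]; first by case: (hy1 j).
  by apply: hy2; split=> //; apply: fW0.
have [y0 [Wy0 fy0]] : exists x, W x /\ f x = d by apply/hd; exists 1; rewrite mul1r.
pose y' (j : 'I_n.+1) := if unlift ord0 j is Some i then y i else y0.
have y'E c : lincomb y' c = c 0 0 *: y0 + lincomb y (\row_i c 0 (lift ord0 i)).
  rewrite /lincomb big_ord_recl /y' unlift_none; congr (_ + _).
  by apply: eq_bigr => i _; rewrite liftK mxE.
have fker c : f (lincomb y c) = 0 /\ W (lincomb y c).
  by apply/and_comm; apply: (lincomb_in _ hker); case: hy.
exists n.+1, y'; split; last first.
  move=> j; rewrite /y'; case: unliftP => [i _ _|->]; last by rewrite eqxx.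
  by case: hy => /(_ i) [].
apply: is_basis_intro.
- move=> j; rewrite /y'; case: unliftP => // i _.
  by case: hy => /(_ i) [].
- move=> m Wm; have [r hr] : exists r, f m = r * d by apply/hd; exists m.
  have [|c hc] := is_basis_span (m := - r *: y0 + m) hy.
    split; first by apply: WD => //; apply: WZ.
    by rewrite fW // fy0 hr mulNr addNr.
  exists (row_mx r%:M c); rewrite y'E.
  have -> : (row_mx r%:M c : 'rV_(1 + n)) 0 0 = r.
    by rewrite mxE; case: splitP => // i _; rewrite ord1 mxE eqxx.
  have -> : \row_i (row_mx r%:M c : 'rV_(1 + n)) 0 (lift ord0 i) = c.
    apply/rowP=> i; rewrite !mxE; case: splitP => [[[|//] //]|k /= [ik]].
    by congr (c _ _); apply: val_inj.
  by rewrite -hc scaleNr addrA addrN add0r.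
move=> c; rewrite y'E => hc0.
have c00 : c 0 0 = 0.
  have := congr1 f hc0; rewrite f0 fW //; last by case: (fker (\row_i c 0 (lift ord0 i))).
  case: (fker (\row_i c 0 (lift ord0 i))) => -> _; rewrite fy0 addr0 => /eqP.
  by rewrite mulf_eq0 (negbTE d0) orbF => /eqP.
move: hc0; rewrite c00 scale0r add0r => /(is_basis_free hker hy) hc.
apply/rowP=> j; rewrite mxE; case: (unliftP ord0 j) => [i ->|-> //].
by move/rowP/(_ i): hc; rewrite !mxE.
Qed.

(** Induction on k through the kernel of the first functional. The ambient O^k enters only through
    functionals separating the points of W, so W may sit in any module. *)
Lemma pid_submodule_basis k (f : 'I_k -> M -> O) W :
  is_submodule W ->
  (forall i o x x', W x -> W x' -> f i (o *: x + x') = o * f i x + f i x') ->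
  (forall x, W x -> (forall i, f i x = 0) -> x = 0) ->
  exists n (y : 'I_n -> M), is_basis W y.
Proof.
elim: k f W => [|k IH] f W hW hf hinj.
  exists 0%N, (fun _ => 0); apply: is_basis_intro => [[]//|m Wm|c _].
    by exists 0; rewrite linear0; apply: hinj => // -[].
  by apply/rowP => -[].
have [W0 WD WZ] := hW.
have f0 i : f i 0 = 0.
  by have := hf i (-1) 0 0 W0 W0; rewrite scaler0 addr0 mulN1r addNr.
have [||x [Wx fx] hx|n [y hy]] :=
    IH (fun i => f (lift ord0 i)) (fun x => W x /\ f ord0 x = 0).
- split=> // [x x' [Wx fx] [Wx' fx']|o x [Wx fx]].
    by split; [apply: WD | rewrite -[x]scale1r hf // fx fx' mulr0 addr0].
  by split; [apply: WZ | rewrite -[_ *: _]addr0 hf // fx f0 mulr0 addr0].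
- by move=> i o x x' [Wx _] [Wx' _]; apply: hf.
- by apply: hinj => // i; case: (unliftP ord0 i) => [j ->|->].
have [n' [y' [hy' _]]] := rebase_along hW (hf ord0) hy.
by exists n', y'.
Qed.
End Lincomb.

(** * Complements of the norm kernel *)

Section ComplementBasis.
Variables (O : idomainType) (M : lmodType O) (W : M -> Prop).
Hypothesis W_sub : is_submodule W.

(** The images of y form a basis of M/W. A complement is then recovered as the span of y, so y alone
    carries the splitting. *)
Definition is_complement_basis n (y : 'I_n -> M) :=
  (forall m, exists c, W (m - lincomb y c)) /\
  (forall c, W (lincomb y c) -> c = 0).

Definition linspan n (y : 'I_n -> M) m := exists c, m = lincomb y c.

Lemma linspan_submodule n (y : 'I_n -> M) : is_submodule (linspan y).
Proof.
split; first by exists 0; rewrite linear0.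
- by move=> _ _ [c ->] [c' ->]; exists (c + c'); rewrite linearD.
- by move=> o _ [c ->]; exists (o *: c); rewrite linearZ.
Qed.

Lemma complement_basis_uniq n (y : 'I_n -> M) m c c' :
  is_complement_basis y -> W (m - lincomb y c) -> W (m - lincomb y c') -> c = c'.
Proof.
case=> _ hf h h'; apply/eqP; rewrite -subr_eq0; apply/eqP/hf.
have := submoduleB W_sub h' h.
by rewrite opprB addrC addrA subrK -linearB.
Qed.

Lemma complement_basis_coord n (y : 'I_n -> M) : is_complement_basis y ->
  exists k : M -> 'rV[O]_n, [/\ forall m, W (m - lincomb y (k m)), linear k
    & forall c, k (lincomb y c) = c].
Proof.
move=> hy; have [k hk] := choice (proj1 hy); have [W0 WD WZ] := W_sub.
exists k; split=> // [o m m'|c]; apply: (complement_basis_uniq hy (hk _)).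
  by rewrite linearP opprD addrACA -scalerBr; apply: WD => //; apply: WZ.
by rewrite subrr.
Qed.

Lemma rank_complement_basis n :
  quotient_has_rank W n <-> exists y : 'I_n -> M, is_complement_basis y.
Proof.
have [W0 _ _] := W_sub.
split=> -[y hy]; exists y.
  split=> [m|c hc]; first by have [c [hc _]] := hy m; exists c.
  have [c0 [_ hu]] := hy (lincomb y c).
  by rewrite -(hu c) ?(hu 0) // -/(lincomb _ _) ?subrr // linear0 subr0.
move=> m; have [c hc] := proj1 hy m; exists c; split=> // c'.
exact: complement_basis_uniq.
Qed.

Lemma complement_basisP n (y : 'I_n -> M) X :
  is_complement W X -> is_basis X y -> is_complement_basis y.
Proof.
move=> [hX WX hs] hy; split=> [m|c hc].
  have [x [w [Xx Ww ->]]] := hs m; have [c hc] := is_basis_span hy Xx.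
  by exists c; rewrite -hc addrC addKr.
apply: (is_basis_free hX hy); apply: WX => //.
by apply: lincomb_in => //; case: hy.
Qed.

Lemma linspan_complement n (y : 'I_n -> M) :
  is_complement_basis y -> is_complement W (linspan y) /\ is_basis (linspan y) y.
Proof.
case=> hs hf; split.
  split; first exact: linspan_submodule.
    by move=> m + [c ec]; rewrite ec => /hf ->; rewrite linear0.
  move=> m; have [c hc] := hs m; exists (lincomb y c), (m - lincomb y c).
  by split=> //; [exists c | rewrite addrC subrK].
have [W0 _ _] := W_sub; apply: is_basis_intro => // [j|c hc].
  by exists (delta_mx 0 j); rewrite lincomb_delta.
by apply: hf; rewrite hc.
Qed.

Lemma complement_basis_shift n (y y' : 'I_n -> M) : is_complement_basis y ->
  (forall j, W (y j - y' j)) -> is_complement_basis y'.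
Proof.
move=> [hs hf] hyy; have [W0 WD WZ] := W_sub.
have hc c : W (lincomb y c - lincomb y' c).
  rewrite /lincomb -sumrB; apply: submodule_sum => // j.
  by rewrite -scalerBr; apply: WZ.
split=> [m|c h]; last first.
  by apply: hf; rewrite -(subrK (lincomb y' c) (lincomb y c)); apply: WD.
have [c h] := hs m; exists c.
by rewrite -(subrK (lincomb y c) m) -addrA; apply: WD.
Qed.

Lemma complement_basis_change n n' (y : 'I_n -> M) (y' : 'I_n' -> M) :
  is_complement_basis y -> is_complement_basis y' ->
  exists (A : 'M_(n, n')) (B : 'M_(n', n)),
    [/\ A *m B = 1%:M, B *m A = 1%:M & forall j, W (y' j - lincomb y (row j B))].
Proof.
have gen p q (u : 'I_p -> M) (v : 'I_q -> M) : is_complement_basis u ->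
    exists A : 'M_(q, p), forall j, W (v j - lincomb u (row j A)).
  case=> hs _; have [c hc] := fin_all_exists (fun j => hs (v j)).
  by exists (\matrix_j c j) => j; rewrite rowK.
have prod p q (u : 'I_p -> M) (v : 'I_q -> M) (A : 'M_(q, p)) (B : 'M_(p, q)) :
    is_complement_basis u -> (forall j, W (v j - lincomb u (row j A))) ->
    (forall j, W (u j - lincomb v (row j B))) -> B *m A = 1%:M.
  move=> hu hA hB; have [_ WD WZ] := W_sub.
  apply/row_matrixP=> i; apply: (complement_basis_uniq (m := u i) hu); last first.
    by rewrite row1 lincomb_delta subrr; case: W_sub.
  rewrite -(subrK (lincomb v (row i B)) (u i)) -addrA; apply: WD => //.
  have -> : lincomb u (row i (B *m A)) = \sum_j B i j *: lincomb u (row j A).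
    rewrite row_mul mulmx_sum_row linear_sum; apply: eq_bigr => j _.
    by rewrite linearZ mxE.
  rewrite [lincomb v _]/lincomb -sumrB; apply: submodule_sum => // j.
  by rewrite mxE -scalerBr; apply: WZ.
move=> hy hy'; have [A hA] := gen _ _ _ y hy'; have [B hB] := gen _ _ _ y' hy.
exists A, B; split=> //; [exact: prod hy hB hA | exact: prod hy' hA hB].
Qed.

Lemma rank_unique n n' : quotient_has_rank W n -> quotient_has_rank W n' -> n = n'.
Proof.
move=> /rank_complement_basis [y hy] /rank_complement_basis [y' hy'].
have [A [B [AB BA _]]] := complement_basis_change hy hy'.
by apply/eqP; rewrite eqn_leq (mulmx1_min AB) (mulmx1_min BA).
Qed.

(** The elimination step: f i stands for the residue of gamma - 1 at y i, and the new basis has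
    nonzero residue at most at its first element. *)
Lemma complement_basis_adapted n (y : 'I_n -> M) (f : 'I_n -> O) :
  is_pid O -> is_complement_basis y ->
  exists n' (y' : 'I_n' -> M) (k : 'I_n' -> 'rV_n),
    [/\ is_complement_basis y', forall j, y' j = lincomb y (k j)
      & forall j : 'I_n', j != 0%N :> nat -> \sum_i k j 0 i * f i = 0].
Proof.
move=> hpid hy; have [k [hk klin kK]] := complement_basis_coord hy.
pose F m := \sum_i k m 0 i * f i.
have Flin o m m' : F (o *: m + m') = o * F m + F m'.
  rewrite /F klin mulr_sumr -big_split; apply: eq_bigr => i _ /=.
  by rewrite !mxE mulrDl mulrA.
have F0 : F 0 = 0 by have := Flin (-1) 0 0; rewrite scaler0 addr0 mulN1r addNr.
have k0 : k 0 = 0 by rewrite -(linear0 (lincomb y)) kK.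
have hker : is_submodule (fun x => linspan y x /\ F x = 0).
  have [s0 sD sZ] := linspan_submodule y; split=> //.
  - move=> x x' [hx fx] [hx' fx']; split; first exact: sD.
    by rewrite -[x]scale1r Flin fx fx' mulr0 addr0.
  - move=> o x [hx fx]; split; first exact: sZ.
    by rewrite -[_ *: _]addr0 Flin fx F0 mulr0 addr0.
have [||p [v hv]] := pid_submodule_basis hpid (f := fun i m => k m 0 i) hker.
- by move=> i o x x' _ _; rewrite klin !mxE.
- move=> _ [[c ->] _] h; rewrite kK in h; suff -> : c = 0 by rewrite linear0.
  by apply/rowP=> i; rewrite h mxE.
have [n' [y' [hy' hF]]] := rebase_along hpid (linspan_submodule y)
  (fun o x x' _ _ => Flin o x x') hv.
have [hc _] := linspan_complement hy.
exists n', y', (fun j => k (y' j)); split=> //; first exact: complement_basisP hc hy'.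
by move=> j; have [c ->] := proj1 hy' j; rewrite kK.
Qed.
End ComplementBasis.

(** * The norm element of a module over a cyclic group *)

Section NormKernel.
Variables (O : idomainType) (C : finGroupType) (g : C).
Hypothesis hg : generator [set: C] g.
Variable M : gmodule O C.

Definition norm_elt (m : M) : M := \sum_(h : C) gm_act h m.

Lemma norm_elt_is_linear : linear norm_elt.
Proof.
move=> o m m'; rewrite /norm_elt scaler_sumr -big_split; apply: eq_bigr => h _ /=.
by rewrite linearP.
Qed.

HB.instance Definition _ := GRing.isLinear.Build O M M _ norm_elt norm_elt_is_linear.

Lemma act_norm_elt h m : gm_act h (norm_elt m) = norm_elt m.
Proof.
rewrite /norm_elt linear_sum [RHS](reindex_inj (mulgI h)) /=.
by apply: eq_bigr => k _; rewrite gm_actM.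
Qed.

Lemma norm_elt_act h m : norm_elt (gm_act h m) = norm_elt m.
Proof.
rewrite /norm_elt [RHS](reindex_inj (mulIg h)) /=.
by apply: eq_bigr => k _; rewrite gm_actM.
Qed.

Lemma norm_elt_norm m : norm_elt (norm_elt m) = #|C|%:R *: norm_elt m.
Proof.
rewrite {1}/norm_elt (eq_bigr (fun _ => norm_elt m)); last by move=> h _;
  apply: act_norm_elt.
by rewrite sumr_const scaler_nat.
Qed.

Lemma norm_kernelE m : norm_kernel M m <-> norm_elt m = 0.
Proof. by []. Qed.

Lemma norm_kernel_submodule : is_submodule (norm_kernel M).
Proof.
split.
- exact: (linear0 norm_elt).
- by move=> x y /norm_kernelE hx /norm_kernelE hy; apply/norm_kernelE;
    rewrite linearD /= hx hy addr0.
- by move=> o x /norm_kernelE hx; apply/norm_kernelE; rewrite linearZ /= hx scaler0.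
Qed.

Lemma norm_kernel_act h m : norm_kernel M m -> norm_kernel M (gm_act h m).
Proof. by move=> hm; apply/norm_kernelE; rewrite norm_elt_act. Qed.

Lemma norm_kernel_diff h m : norm_kernel M (gm_act h m - m).
Proof. by apply/norm_kernelE; rewrite linearB /= norm_elt_act subrr. Qed.

(** Up to the factor #|C| this is a projection onto the norm kernel; it allows a map defined there
    to be extended to M. *)
Lemma norm_kernel_proj m : norm_kernel M (#|C|%:R *: m - norm_elt m).
Proof. by apply/norm_kernelE; rewrite linearB linearZ /= norm_elt_norm subrr. Qed.

Lemma generator_expg h : exists k, h = (g ^+ k)%g.
Proof.
by have /cycleP [k ->] : h \in <[g]>%g; [rewrite -(eqP hg) inE | exists k].
Qed.

Lemma gm_act_exp k m : gm_act (g ^+ k)%g m = iter k (@gm_act _ _ M g) m.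
Proof. by elim: k => [|k IH]; rewrite ?expg0 ?gm_act1 // expgS gm_actM IH. Qed.

Lemma fg_free_coord : is_fg_free M -> exists n (f : 'I_n -> M -> O),
  (forall i o m m', f i (o *: m + m') = o * f i m + f i m') /\
  (forall m, (forall i, f i m = 0) -> m = 0).
Proof.
case=> n [y hy]; have hs m := is_basis_span (m := m) hy I.
have hT : is_submodule (fun _ : M => True) by [].
have [k hk] := choice hs; exists n, (fun i m => k m 0 i); split.
  move=> i o m m'; suff -> : k (o *: m + m') = o *: k m + k m' by rewrite !mxE.
  by apply: (is_basis_unique hT hy); rewrite linearP /= -!hk.
by move=> m h; rewrite (hk m) (_ : k m = 0) ?linear0 //; apply/rowP=> i; rewrite h mxE.
Qed.

(** The norm identifies M/M_N with its image, a submodule of a free module and so free; preimages of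
    a basis of the image are taken. *)
Lemma norm_kernel_complement_basis : is_pid O -> is_fg_free M ->
  exists n (y : 'I_n -> M), is_complement_basis (norm_kernel M) y.
Proof.
move=> hpid /fg_free_coord [k [f [flin finj]]].
pose W (m : M) := exists m', m = norm_elt m'.
have hW : is_submodule W.
  split; first by exists 0; rewrite linear0.
  - by move=> _ _ [m ->] [m' ->]; exists (m + m'); rewrite linearD.
  - by move=> o _ [m ->]; exists (o *: m); rewrite linearZ.
have [n [e he]] := pid_submodule_basis hpid hW (fun i o x x' _ _ => flin i o x x')
  (fun x _ => finj x).
have [y hy] := fin_all_exists (proj1 he : forall j, W (e j)).
have ye c : norm_elt (lincomb y c) = lincomb e c.
  by rewrite /lincomb linear_sum; apply: eq_bigr => j _; rewrite linearZ hy.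
exists n, y; split=> [m|c /norm_kernelE]; last by rewrite ye;
  apply: (is_basis_free hW he).
have [|c hc] := is_basis_span (m := norm_elt m) he; first by exists m.
by exists c; apply/norm_kernelE; rewrite linearB /= ye hc subrr.
Qed.
End NormKernel.

(** * Modules over the cyclotomic order *)

Section CyclotomicOrder.
Variables (K : fieldType) (L : fieldExtType K).
Variables (O : idomainType) (iO : {rmorphism O -> K}).
Variables (l : nat) (z : L) (R : idomainType) (iR : {rmorphism R -> L}).
Hypothesis iO_inj : injective iO.
Hypothesis iO_frac : forall x : K, exists o o', o != 0 /\ iO o * x = iO o'.
Hypotheses (hl : prime l) (l_neq0 : l%:R != 0 :> O).
Hypotheses (hz : l.-primitive_root z) (hL : <<1%VS; z>>%VS = fullv).
Hypothesis hR : is_adjunction iO z iR.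
Hypotheses (hpid : is_pid O) (hded : is_dedekind R).
Implicit Types (x y t w : L) (a : L -> Prop) (o : O) (r : R).

Definition integral_elt x := exists r, iR r = x.

Lemma iR_inj : injective iR. Proof. by case: hR. Qed.

Lemma integral_eltD x y :
  integral_elt x -> integral_elt y -> integral_elt (x + y).
Proof. by move=> [r <-] [s <-]; exists (r + s); rewrite rmorphD. Qed.

Lemma integral_eltM x y :
  integral_elt x -> integral_elt y -> integral_elt (x * y).
Proof. by move=> [r <-] [s <-]; exists (r * s); rewrite rmorphM. Qed.

Lemma integral_elt_horner (p : {poly O}) :
  integral_elt (map_poly (in_alg L \o iO) p).[z].
Proof. by case: hR => _ hx; apply/hx; exists p. Qed.

Lemma integral_elt_scalar o : integral_elt (iO o)%:A.
Proof. by have := integral_elt_horner o%:P; rewrite map_polyC hornerC. Qed.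

Lemma integral_elt_exp k : integral_elt (z ^+ k).
Proof. by have := integral_elt_horner 'X^k; rewrite map_polyXn hornerXn. Qed.

Lemma integral_elt_poly r :
  exists p : {poly O}, iR r = (map_poly (in_alg L \o iO) p).[z].
Proof. by case: hR => _ hx; apply/hx; exists r. Qed.

Lemma z1_neq0 : z - 1 != 0.
Proof.
rewrite subr_eq0; apply: contraTneq (prime_gt1 hl) => z1.
have := eq_prim_root_expr hz 1 0; rewrite expr1 expr0 z1 eqxx mod0n => /esym.
by case: l hl => [|[|]] // n _; rewrite modn_small.
Qed.

(** On R this is [eq_mod_z1]. Working in L lets products of elements of a and a^-1 appear without
    preimages in R. *)
Definition cong x y := exists t : R, x - y = (z - 1) * iR t.

Lemma cong_refl x : cong x x.
Proof. by exists 0; rewrite subrr rmorph0 mulr0. Qed.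

Lemma cong_sym x y : cong x y -> cong y x.
Proof. by case=> t h; exists (- t); rewrite rmorphN mulrN -h opprB. Qed.

Lemma cong_trans y x t : cong x y -> cong y t -> cong x t.
Proof.
by case=> u h [v h']; exists (u + v); rewrite rmorphD mulrDr -h -h' addrA subrK.
Qed.

Lemma congD x y x' y' : cong x y -> cong x' y' -> cong (x + x') (y + y').
Proof.
by case=> u h [v h']; exists (u + v); rewrite rmorphD mulrDr -h -h'; ring.
Qed.

Lemma congMl r x y : cong x y -> cong (iR r * x) (iR r * y).
Proof. by case=> u h; exists (r * u); rewrite rmorphM mulrCA -h mulrBr. Qed.

Lemma horner_cong (p : {poly O}) :
  cong (map_poly (in_alg L \o iO) p).[z] (iO p.[1])%:A.
Proof.
have /factor_theorem [q hq] : root (p - p.[1]%:P) 1.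
  by rewrite /root !hornerE subrr.
have [r hr] := integral_elt_horner q.
exists r; rewrite hr -{1}(subrK p.[1]%:P p) hq.
rewrite rmorphD rmorphM rmorphB /= map_polyX !map_polyC /= !hornerE rmorph1 scale1r.
by rewrite addrK mulrC.
Qed.

(** R is generated over O by z, which is 1 modulo z - 1, so p(z) reduces to p(1). *)
Lemma residue_scalar r : exists o, cong (iR r) (iO o)%:A.
Proof. by have [p ->] := integral_elt_poly r; exists p.[1]; apply: horner_cong. Qed.

(** The polynomial 1 + X + ... + X^(l-1) takes the value l at 1 and vanishes at z. *)
Lemma prime_cong0 : cong (iO l%:R)%:A 0.
Proof.
pose p : {poly O} := \sum_(i < l) 'X^i.
have p1 : p.[1] = l%:R.
  rewrite horner_sum -[l in RHS]card_ord -sumr_const; apply: eq_bigr => i _.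
  by rewrite hornerXn expr1n.
have pz : (map_poly (in_alg L \o iO) p).[z] = \sum_(i < l) z ^+ i.
  rewrite rmorph_sum horner_sum; apply: eq_bigr => i _.
  by rewrite /= map_polyXn hornerXn.
apply: cong_sym; have := horner_cong p; rewrite p1 pz.
suff -> : \sum_(i < l) z ^+ i = 0 by [].
apply: (mulfI z1_neq0); rewrite mulr0 -subrX1.
by rewrite (prim_expr_order hz) subrr.
Qed.

Lemma common_denominator (n : nat) (P : 'I_n -> O -> Prop) :
  (forall i, exists o, o != 0 /\ P i o) ->
  (forall i o o', P i o -> P i (o' * o)) -> exists o, o != 0 /\ forall i, P i o.
Proof.
move=> /fin_all_exists [d hd] hP; exists (\prod_i d i); split.
  by apply/prodf_neq0 => i _; case: (hd i).
by move=> i; rewrite (bigD1 i) //= mulrC; apply: hP; case: (hd i).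
Qed.

Lemma fraction_L x : exists o, o != 0 /\ integral_elt ((iO o)%:A * x).
Proof.
have /Fadjoin1_polyP [p ->] : x \in <<1; z>>%VS by rewrite hL memvf.
pose P (i : 'I_(size p)) o := exists o', iO o * p`_i = iO o'.
have [||o [o0 ho]] := common_denominator (P := P).
- by move=> i; have [o [o' [o0 h]]] := iO_frac p`_i; exists o; split=> //; exists o'.
- by move=> i o o' [q h]; exists (o' * q); rewrite !rmorphM -mulrA h.
exists o; split=> //; rewrite horner_poly mulr_sumr.
elim/big_ind: _; [by exists 0; rewrite rmorph0 | exact: integral_eltD | move=> i _].
rewrite mulrA; apply: integral_eltM (integral_elt_exp _).
have [o' h] := ho i; rewrite mulr_algl scalerA h; exact: integral_elt_scalar.
Qed.

Lemma root_of_unity_power w w' : l.-primitive_root w -> l.-primitive_root w' ->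
  exists k, w' = w ^+ k.
Proof.
move=> hw /prim_expr_order /(prim_rootP hw) [k ->].
by exists k.
Qed.

(** A geometric sum, w' being a power of w. By symmetry w - 1 and w' - 1 generate the same ideal of
    R. *)
Lemma root_of_unity_dvd w w' : l.-primitive_root w -> l.-primitive_root w' ->
  exists s, integral_elt s /\ w' - 1 = s * (w - 1).
Proof.
move=> hw hw'; have [k ->] := root_of_unity_power hw hw'.
exists (\sum_(i < k) w ^+ i); rewrite subrX1 mulrC; split=> //.
have [j ->] := root_of_unity_power hz hw.
elim/big_ind: _; [by exists 0; rewrite rmorph0 | exact: integral_eltD | move=> i _].
by rewrite -exprM; apply: integral_elt_exp.
Qed.

(** * Fractional ideals: invertibility and reduction modulo z - 1 *)

Section FractionalIdeal.
Variables (a : L -> Prop) (ha : is_fractional_ideal iR a).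

Lemma fideal_D x y : a x -> a y -> a (x + y). Proof. by case: ha => _ + _ _; apply. Qed.

Lemma fideal_M r x : a x -> a (iR r * x). Proof. by case: ha => _ _ + _; apply. Qed.

Lemma fideal_integral x y : integral_elt x -> a y -> a (x * y).
Proof. by case=> r <-; apply: fideal_M. Qed.

Lemma fideal_0 : a 0.
Proof. by case: ha => -[x /(fideal_M 0)]; rewrite rmorph0 mul0r. Qed.

Lemma fideal_N x : a x -> a (- x).
Proof. by move/(fideal_M (-1)); rewrite rmorphN1 mulN1r. Qed.

Lemma fideal_Z o x : a x -> a (iO o *: x).
Proof. by move=> ax; rewrite -mulr_algl;
  apply: fideal_integral (integral_elt_scalar o) ax. Qed.

Definition inverse_elt y := forall x, a x -> integral_elt (y * x).

(** This is a a^-1 = R, phrased as an induction principle so that sums of products need not be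
    handled. It reduces to the integral ideal d a. *)
Lemma fideal_invertible (T : R -> Prop) : is_ideal T ->
  (forall x y r, a x -> inverse_elt y -> iR r = y * x -> T r) -> T 1.
Proof.
move=> hT hxy; case: (ha) => -[x0 ax0 x0n] aD aM [d d0 hd].
have d0' : iR d != 0 by rewrite -(rmorph0 iR) (inj_eq iR_inj).
have [c hc] := hd _ ax0.
have c0 : iR c != 0 by rewrite -hc mulf_neq0.
pose I r := exists x, a x /\ iR d * x = iR r.
apply: (@dedekind_invertible _ I T c) => //.
- split; first by exists 0; rewrite mulr0 rmorph0; split=> //; apply: fideal_0.
  + move=> r s [x [ax hx]] [y [ay hy]]; exists (x + y); split; first exact: aD.
    by rewrite mulrDr hx hy rmorphD.
  + move=> r s [x [ax hx]]; exists (iR r * x); split; first exact: aM.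
    by rewrite mulrCA hx rmorphM.
- by exists x0.
- by apply: contraNneq c0 => ->; rewrite rmorph0.
(* For I = d a, an element b with b I inside (c) yields the element b d / c of a^-1. *)
move=> i b r [x [ax hx]] hb hr; apply: (hxy x (iR b * iR d / iR c)) => //.
  move=> y ay; have [s hs] := hd _ ay.
  have [|q hq] := hb s; first by exists y.
  exists q; apply: (mulIf c0); rewrite -[LHS]rmorphM -hq rmorphM -hs.
  by rewrite [RHS]mulrAC divfK //; ring.
apply: (mulIf c0); rewrite -[LHS]rmorphM -hr rmorphM -hx.
by rewrite [RHS]mulrAC divfK //; ring.
Qed.

(* The ideal of all r congruent to y x for some y, with x fixed, is enlarged by
   a suitable choice of x until it contains 1: this is [pid_stable_range]. *)
Lemma fideal_generator_mod : exists x y, [/\ a x, inverse_elt y & cong (y * x) 1].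
Proof.
have inv0 : inverse_elt 0 by move=> x _; rewrite mul0r; exists 0; rewrite rmorph0.
have invD y y' : inverse_elt y -> inverse_elt y' -> inverse_elt (y + y').
  by move=> hy hy' x ax; rewrite mulrDl; apply: integral_eltD; [apply: hy | apply: hy'].
have invM y t : integral_elt t -> inverse_elt y -> inverse_elt (t * y).
  by move=> ht hy x ax; rewrite -mulrA; apply: integral_eltM => //; apply: hy.
pose T r := exists x y, [/\ a x, inverse_elt y & cong (y * x) (iR r)].
suff [x [y [ax hy h]]] : T 1 by exists x, y; rewrite rmorph1 in h.
apply: fideal_invertible => [|x y r ax hy hr]; last first.
  by exists x, y; split=> //; rewrite hr; apply: cong_refl.
split.
- by exists 0, 0; rewrite mulr0 rmorph0; split; [apply: fideal_0 | | apply: cong_refl].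
(* Sums are the obstacle: r1 and r2 come with different x1 and x2, and a single x has to serve both.
   P collects the scalar residues of (y x1, y x2) for y in a^-1. *)
- move=> r1 r2 [x1 [y1 [ax1 hy1 h1]]] [x2 [y2 [ax2 hy2 h2]]].
  pose P p q := exists y, [/\ inverse_elt y, cong (y * x1) (iO p)%:A
    & cong (y * x2) (iO q)%:A].
  have Pex y : inverse_elt y -> exists p q,
      [/\ P p q, cong (y * x1) (iO p)%:A & cong (y * x2) (iO q)%:A].
    move=> hy; have [s1 e1] := hy _ ax1; have [s2 e2] := hy _ ax2.
    have [p hp] := residue_scalar s1; have [q hq] := residue_scalar s2.
    by exists p, q; split; [exists y; split=> // | | ]; rewrite -?e1 -?e2.
  have P0 : cong 0 (iO 0)%:A by rewrite rmorph0 scale0r; apply: cong_refl.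
  have Pl : cong 0 (iO l%:R)%:A by apply: cong_sym; apply: prime_cong0.
  have [||||o ho] := pid_stable_range hpid (P := P) l_neq0.
  + by exists 0; rewrite !mul0r.
  + by exists 0; rewrite !mul0r.
  + move=> p q p' q' [y [hy h h']] [y' [hy' g g']]; exists (y + y').
    rewrite !mulrDl !rmorphD !scalerDl; split; [exact: invD | exact: congD..].
  + move=> s p q [y [hy h h']]; have [s' hs'] := integral_elt_scalar s.
    exists ((iO s)%:A * y); split; first by apply: invM => //; exists s'.
    * by rewrite rmorphM -scalerA -[_ *: (_)%:A]mulr_algl -mulrA -hs'; apply: congMl.
    * by rewrite rmorphM -scalerA -[_ *: (_)%:A]mulr_algl -mulrA -hs'; apply: congMl.
  pose x := x1 + iO o *: x2.
  have ax : a x by apply: fideal_D => //; apply: fideal_Z.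
  have [s hs] := integral_elt_scalar o.
  have key p q : P p q -> exists2 y, inverse_elt y & cong (y * x) (iO (p + o * q))%:A.
    case=> y [hy h h']; exists y => //.
    rewrite /x -[iO o *: x2]mulr_algl mulrDr mulrCA rmorphD rmorphM scalerDl -scalerA.
    rewrite -[_ *: (_)%:A]mulr_algl -hs; apply: congD => //; exact: congMl.
  have [p1 [q1 [P1 hp1 _]]] := Pex _ hy1.
  have [p2 [q2 [P2 _ hq2]]] := Pex _ hy2.
  (* Stable range turns each coordinate p1 and q2 into a value p + o q on P, that is, into the
     residue of t x for some t in a^-1. *)
  have [[p' [q' [/key [t1 ht1 e1] ep]]] _] := ho _ _ P1.
  have [_ [p'' [q'' [/key [t2 ht2 e2] eq]]]] := ho _ _ P2.
  exists x, (t1 + t2); split=> //; first exact: invD.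
  rewrite mulrDl rmorphD; apply: congD.
    apply: cong_trans h1; apply: cong_trans (cong_sym hp1).
    by rewrite ep.
  apply: cong_trans h2; apply: cong_trans (cong_sym hq2).
  by rewrite eq.
- move=> t r [x [y [ax hy h]]]; exists (iR t * x), y; split=> //; first exact: fideal_M.
  by rewrite mulrCA rmorphM; apply: congMl.
Qed.

(** If y b = 1 modulo z - 1 with y in a^-1, then multiplication by y, from a/(z-1)a to R/(z-1), is
    inverse to multiplication by b. *)
Lemma fideal_basis : exists x, is_basis_mod_z1 iR z a x.
Proof.
have [b [y [ab hy [t ht]]]] := fideal_generator_mod; exists b; split=> //.
  move=> x ax; have [r hr] := hy _ ax.
  exists r, (- (iR t * x)); split; first by apply: fideal_N; apply: fideal_M.
  by rewrite hr mulrN mulrA -ht; ring.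
move=> r s as' hrs; have [q hq] := hy _ as'.
apply: (@cong_trans (iR r * (y * b))).
  by rewrite -[X in cong X _]mulr1; apply: congMl; apply: cong_sym; exists t.
by exists q; rewrite rmorph0 subr0 mulrCA hrs mulrCA hq.
Qed.

(** For x in a and y in a^-1 the product t x y is in R, and such x y generate R. Applied to t and
    t^-1, this turns the ratio of two isomorphisms onto a into a unit of R. *)
Lemma fideal_stable_integral t : (forall x, a x -> a (t * x)) -> integral_elt t.
Proof.
move=> ht; pose T r := integral_elt (iR r * t).
suff : T 1 by rewrite /T rmorph1 mul1r.
apply: fideal_invertible.
  split.
  - by exists 0; rewrite !rmorph0 mul0r.
  - by move=> r s hr hs; rewrite /T rmorphD mulrDl; apply: integral_eltD.
  - by move=> r s hs; rewrite /T rmorphM -mulrA; apply: integral_eltM => //; exists r.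
by move=> x y r ax hy hr; rewrite /T hr -mulrA [x * t]mulrC; apply: hy; apply: ht.
Qed.
End FractionalIdeal.

Variables (C : finGroupType) (g : C).
Hypotheses (hC : #|C| = l) (hg : generator [set: C] g).

(** M_N carries only the actions of O and g; this extends them to R, since z is a power of w. Pairs
    are used so that two embeddings can be followed at once. *)
Lemma adjunction_closed w (Q : L -> L -> Prop) :
  l.-primitive_root w ->
  (forall x y x' y', Q x y -> Q x' y' -> Q (x + x') (y + y')) ->
  (forall o x y, Q x y -> Q (iO o *: x) (iO o *: y)) ->
  (forall x y, Q x y -> Q (w * x) (w * y)) ->
  forall r x y, Q x y -> Q (iR r * x) (iR r * y).
Proof.
move=> hw QD QZ Qw r x y Qxy; have [p ->] := integral_elt_poly r.
have [k ez] := root_of_unity_power hw hz.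
have Q0 : Q 0 0 by have := QZ 0 _ _ Qxy; rewrite rmorph0 !scale0r.
have Qwk i x' y' : Q x' y' -> Q (w ^+ i * x') (w ^+ i * y').
  by elim: i => [|i IH] h; rewrite ?expr0 ?mul1r // exprS -!mulrA; apply/Qw/IH.
rewrite horner_coef !mulr_suml.
elim/big_ind2: _ => [//|x1 x2 y1 y2|i _]; first exact: QD.
rewrite coef_map /= !mulr_algl -!scalerAl.
by apply: QZ; rewrite ez -exprM; apply: Qwk.
Qed.

(** * Embeddings of the norm kernel in L *)

Section Embedding.
Variables (w : L) (M : gmodule O C) (phi : M -> L).
Hypothesis hphi : norm_kernel_embedding iO g w phi.
Implicit Types m : M.

Let nk_sub := norm_kernel_submodule M.

Lemma embD m m' : norm_kernel M m -> norm_kernel M m' -> phi (m + m') = phi m + phi m'.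
Proof. by case: hphi => h _ _ _; apply: h. Qed.

Lemma embZ o m : norm_kernel M m -> phi (o *: m) = iO o *: phi m.
Proof. by case: hphi => _ h _ _; apply: h. Qed.

Lemma emb_act m : norm_kernel M m -> phi (gm_act g m) = w * phi m.
Proof. by case: hphi => _ _ h _; apply: h. Qed.

Lemma emb0 : phi 0 = 0.
Proof.
have [n0 _ _] := nk_sub.
by have := embZ 0 n0; rewrite scaler0 rmorph0 scale0r.
Qed.

Lemma embB m m' : norm_kernel M m -> norm_kernel M m' -> phi (m - m') = phi m - phi m'.
Proof.
move=> hm hm'; have [_ _ nkZ] := nk_sub.
rewrite -[- m']scaleN1r embD //; last exact: nkZ.
by rewrite embZ // rmorphN1 scaleN1r.
Qed.

Lemma emb_inj m m' : norm_kernel M m -> norm_kernel M m' -> phi m = phi m' -> m = m'.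
Proof.
move=> hm hm' e; apply/eqP; rewrite -subr_eq0; apply/eqP.
case: hphi => _ _ _; apply; first exact: submoduleB.
by rewrite embB // e subrr.
Qed.

(** The map gamma - 1 with values read in L. On the norm kernel it is multiplication by w - 1. *)
Definition twist m := phi (gm_act g m - m).

Lemma twist_linear o m m' : twist (o *: m + m') = iO o *: twist m + twist m'.
Proof.
rewrite /twist linearP /= opprD addrACA -scalerBr embD ?embZ //;
  try exact: norm_kernel_diff.
by case: nk_sub => _ _; apply; apply: norm_kernel_diff.
Qed.

Lemma twist0 : twist 0 = 0.
Proof. by rewrite /twist linear0 subrr emb0. Qed.

Lemma twist_lincomb n (y : 'I_n -> M) c :
  twist (lincomb y c) = \sum_j iO (c 0 j) *: twist (y j).
Proof.
rewrite /lincomb (big_morph twist (id1 := 0) (op1 := +%R)) //; first last.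
- exact: twist0.
- by move=> m m'; have := twist_linear 1 m m'; rewrite scale1r rmorph1 scale1r.
apply: eq_bigr => j _.
by have := twist_linear (c 0 j) (y j) 0; rewrite !addr0 twist0 addr0.
Qed.

Lemma embedding_fideal : l.-primitive_root w -> is_fg_free M ->
  (forall x, exists o m, [/\ o != 0, norm_kernel M m & iO o *: x = phi m]) ->
  is_fractional_ideal iR (fun x => exists2 m, norm_kernel M m & phi m = x).
Proof.
have [_ nkD nkZ] := nk_sub.
move=> hw [n [y hy]] hx; split.
- have [o [m [o0 hm ho]]] := hx 1; exists (phi m); first by exists m.
  rewrite -ho scaler_eq0 oner_eq0 orbF; apply: contraNneq o0 => h.
  by apply/eqP/iO_inj; rewrite h rmorph0.
- by move=> _ _ [m hm <-] [m' hm' <-]; exists (m + m'); [apply: nkD | rewrite embD].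
- move=> r x;
    apply: (@adjunction_closed w (fun x _ => exists2 m, norm_kernel M m & phi m = x)
    hw _ _ _ r x 0).
  + by move=> _ _ _ _ [m hm <-] [m' hm' <-]; exists (m + m'); [apply: nkD | rewrite embD].
  + by move=> o _ _ [m hm <-]; exists (o *: m); [apply: nkZ | rewrite embZ].
  + by move=> _ _ [m hm <-]; exists (gm_act g m);
      [apply: norm_kernel_act | rewrite emb_act].
(* An extension of l phi from M_N to all of M. Clearing its denominators on a finite basis of M
   bounds those of phi, without generators of M_N. *)
pose psi m := phi (l%:R *: m - norm_elt m).
have hproj m : norm_kernel M (l%:R *: m - norm_elt m) by rewrite -hC;
  apply: norm_kernel_proj.
have psilin o m m' : psi (o *: m + m') = iO o *: psi m + psi m'.
  rewrite /psi -embZ // -embD //; last exact: nkZ.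
  congr phi; rewrite norm_elt_is_linear scalerBr !scalerDr opprD addrACA.
  by rewrite !scalerA [l%:R * o]mulrC.
have psi0 : psi 0 = 0.
  by have := psilin (-1) 0 0; rewrite scaler0 addr0 rmorphN1 scaleN1r addNr.
have [||D [D0 hD]] := common_denominator (P :=
  fun i o => integral_elt ((iO o)%:A * psi (y i))).
- by move=> i; apply: fraction_L.
- move=> i o o' h; rewrite rmorphM -scalerA -[_ *: (_)%:A]mulr_algl -mulrA.
  by apply: integral_eltM h; apply: integral_elt_scalar.
have [d hd] := integral_elt_scalar (D * l%:R).
exists d.
  apply: contraNneq (mulf_neq0 D0 l_neq0) => d0; move/eqP: hd.
  rewrite d0 rmorph0 eq_sym scaler_eq0 oner_eq0 orbF => /eqP h.
  by apply/eqP/iO_inj; rewrite h rmorph0.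
move=> _ [m hm <-].
suff [r hr] : integral_elt (iR d * phi m) by exists r.
have -> : iR d * phi m = (iO D)%:A * psi m.
  rewrite hd rmorphM !mulr_algl -scalerA -embZ //; congr (_ *: phi _).
  by move/norm_kernelE: hm => ->; rewrite subr0.
have [c ->] := is_basis_span (m := m) hy I.
rewrite /lincomb (big_morph psi (id1 := 0) (op1 := +%R)) //; last first.
  by move=> x x'; have := psilin 1 x x'; rewrite scale1r rmorph1 scale1r.
rewrite mulr_sumr; elim/big_ind: _ => [|x x'|j _].
- by exists 0; rewrite rmorph0.
- exact: integral_eltD.
have := psilin (c 0 j) (y j) 0; rewrite !addr0 psi0 addr0 => ->.
rewrite -scalerAr -[X in integral_elt X]mulr_algl.
by apply: integral_eltM => //; apply: integral_elt_scalar.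
Qed.
End Embedding.

(** Both embeddings are compatible with R, and a nonzero O-multiple of any m is an R-multiple of m0,
    because phi m / phi m0 has a denominator in O. *)
Lemma embedding_ratio w (M : gmodule O C) (phi phi' : M -> L) m0 :
  l.-primitive_root w ->
  norm_kernel_embedding iO g w phi -> norm_kernel_embedding iO g w phi' ->
  norm_kernel M m0 -> phi m0 != 0 ->
  exists2 t, t != 0 & forall m, norm_kernel M m -> phi' m = t * phi m.
Proof.
move=> hw h h' hm0 n0; have [_ nkD nkZ] := norm_kernel_submodule M.
have n0' : phi' m0 != 0.
  apply: contraNneq n0 => e; case: h' => _ _ _ /(_ _ hm0 e) ->.
  by rewrite (emb0 h).
exists (phi' m0 / phi m0); first by rewrite mulf_neq0 ?invr_neq0.
move=> m hm.
have [o [o0 [r hr]]] := fraction_L (phi m / phi m0).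
(* m1 plays the role of r m0, for both embeddings simultaneously. *)
have [m1 hm1 [e1 e2]] : exists2 m1, norm_kernel M m1 &
    phi m1 = iR r * phi m0 /\ phi' m1 = iR r * phi' m0.
  apply: (adjunction_closed hw (Q := fun x y => exists2 m1, norm_kernel M m1 &
    phi m1 = x /\ phi' m1 = y)); last by exists m0.
  + move=> _ _ _ _ [m1 hm1 [<- <-]] [m2 hm2 [<- <-]]; exists (m1 + m2); first exact: nkD.
    by rewrite (embD h) // (embD h').
  + move=> a _ _ [m1 hm1 [<- <-]]; exists (a *: m1); first exact: nkZ.
    by rewrite (embZ h) // (embZ h').
  + move=> _ _ [m1 hm1 [<- <-]]; exists (gm_act g m1); first exact: norm_kernel_act.
    by rewrite (emb_act h) // (emb_act h').
have o0' : (iO o)%:A != 0 :> L.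
  rewrite scaler_eq0 oner_eq0 orbF; apply: contraNneq o0 => e.
  by apply/eqP/iO_inj; rewrite e rmorph0.
have em : o *: m = m1.
  apply: (emb_inj h) => //; first exact: nkZ.
  by rewrite e1 hr (embZ h) // -[LHS]mulr_algl -mulrA divfK.
apply: (mulfI o0'); rewrite mulr_algl -(embZ h') // em e2 hr; ring.
Qed.

Lemma has_ideal_class w (M : gmodule O C) (a a' : L -> Prop) :
  l.-primitive_root w -> is_fractional_ideal iR a -> has_ideal iO g w M a ->
  (has_ideal iO g w M a' <-> same_ideal_class a a').
Proof.
move=> hw ha [phi [h hphi]]; split.
  case=> phi' [h' hphi']; case: (ha) => -[x0 ax0 x0n] _ _ _.
  have /hphi [m0 hm0 e0] := ax0.
  have [|t t0 ht] := embedding_ratio hw h h' hm0; first by rewrite e0.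
  exists t => // x; split=> [/hphi' [m hm]|/hphi [m hm <-]].
    by rewrite ht // => /(mulfI t0) e; apply/hphi; exists m.
  by apply/hphi'; exists m; rewrite ?ht.
case=> t t0 ht; exists (fun m => t * phi m); split.
  split.
  - by move=> m m' hm hm'; rewrite (embD h) // mulrDr.
  - by move=> o m hm; rewrite (embZ h) // scalerAr.
  - by move=> m hm; rewrite (emb_act h) // mulrCA.
  - move=> m hm /eqP; rewrite mulf_eq0 (negbTE t0) => /eqP.
    by case: h => _ _ _; apply.
move=> x; split=> [ax|[m hm <-]]; last by apply/ht/hphi; exists m.
have : a (t^-1 * x) by apply/ht; rewrite mulVKf.
by case/hphi => m hm e; exists m => //; rewrite e mulVKf.
Qed.

(* Two modules split as norm kernel plus complement are compared through the
   graph of the map that is the identity of a on norm kernels and sends y to y'. *)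
Section Glue.
Variables (w : L) (a : L -> Prop) (n : nat).

Definition glue (M M' : gmodule O C) (phi : M -> L) (phi' : M' -> L)
    (y : 'I_n -> M) (y' : 'I_n -> M') (m : M) (m' : M') :=
  exists c k k', [/\ norm_kernel M k, norm_kernel M' k', phi k = phi' k',
    m = lincomb y c + k & m' = lincomb y' c + k'].

Lemma glue_sym (M M' : gmodule O C) (phi : M -> L) (phi' : M' -> L)
    (y : 'I_n -> M) (y' : 'I_n -> M') m m' :
  glue phi phi' y y' m m' -> glue phi' phi y' y m' m.
Proof. by case=> c [k [k' [? ? ? ? ?]]]; exists c, k', k. Qed.

Lemma glue_total (M M' : gmodule O C) (phi : M -> L) (phi' : M' -> L)
    (y : 'I_n -> M) (y' : 'I_n -> M') m :
  norm_kernel_iso iO g w a phi -> norm_kernel_iso iO g w a phi' ->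
  is_complement_basis (norm_kernel M) y -> exists m', glue phi phi' y y' m m'.
Proof.
move=> [h ha] [h' ha'] [hs _]; have [c hc] := hs m.
have /ha' [k' hk' e] : a (phi (m - lincomb y c)) by apply/ha; exists (m - lincomb y c).
exists (lincomb y' c + k'), c, (m - lincomb y c), k'; split=> //.
by rewrite addrC subrK.
Qed.

Lemma glue_unique (M M' : gmodule O C) (phi : M -> L) (phi' : M' -> L)
    (y : 'I_n -> M) (y' : 'I_n -> M') m m1 m2 :
  norm_kernel_iso iO g w a phi' -> is_complement_basis (norm_kernel M) y ->
  glue phi phi' y y' m m1 -> glue phi phi' y y' m m2 -> m1 = m2.
Proof.
move=> [h' _] hy [c1 [k1 [k1' [hk1 hk1' e1 -> ->]]]] [c2 [k2 [k2' [hk2 hk2' e2 em ->]]]].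
have ec : c1 = c2.
  have hW := norm_kernel_submodule M.
  apply: (complement_basis_uniq hW (m := lincomb y c1 + k1) hy);
    first by rewrite addrC addKr.
  by rewrite em addrC addKr.
rewrite -ec in em *; move/addrI: em => ek.
by congr (_ + _); apply: (emb_inj h') => //; rewrite -e1 -e2 ek.
Qed.

Lemma glue_linear (M M' : gmodule O C) (phi : M -> L) (phi' : M' -> L)
    (y : 'I_n -> M) (y' : 'I_n -> M') o m1 m2 m1' m2' :
  norm_kernel_iso iO g w a phi -> norm_kernel_iso iO g w a phi' ->
  glue phi phi' y y' m1 m1' -> glue phi phi' y y' m2 m2' ->
  glue phi phi' y y' (o *: m1 + m2) (o *: m1' + m2').
Proof.
move=> [h _] [h' _] [c1 [k1 [k1' [hk1 hk1' e1 -> ->]]]] [c2 [k2 [k2' [hk2 hk2' e2 -> ->]]]].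
have [_ nkD nkZ] := norm_kernel_submodule M.
have [_ nkD' nkZ'] := norm_kernel_submodule M'.
exists (o *: c1 + c2), (o *: k1 + k2), (o *: k1' + k2'); split.
- by apply: nkD => //; apply: nkZ.
- by apply: nkD' => //; apply: nkZ'.
- rewrite (embD h) ?(embZ h) ?(embD h') ?(embZ h') ?e1 ?e2 //;
    by [apply: nkZ | apply: nkZ'].
- by rewrite linearP /= scalerDr addrACA.
- by rewrite linearP /= scalerDr addrACA.
Qed.

Lemma glue_act (M M' : gmodule O C) (phi : M -> L) (phi' : M' -> L)
    (y : 'I_n -> M) (y' : 'I_n -> M') m m' :
  norm_kernel_iso iO g w a phi -> norm_kernel_iso iO g w a phi' ->
  (forall j, twist phi (y j) = twist phi' (y' j)) ->
  glue phi phi' y y' m m' -> glue phi phi' y y' (gm_act g m) (gm_act g m').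
Proof.
move=> [h _] [h' _] hyy [c [k [k' [hk hk' e -> ->]]]].
have [_ nkD _] := norm_kernel_submodule M.
have [_ nkD' _] := norm_kernel_submodule M'.
(* g keeps the coordinates c and changes the norm kernel part by (g - 1) applied to the combination
   of y. Its image in L depends only on the twists, which agree on both sides. *)
exists c, (gm_act g (lincomb y c) - lincomb y c + gm_act g k),
  (gm_act g (lincomb y' c) - lincomb y' c + gm_act g k'); split.
- by apply: nkD; [apply: norm_kernel_diff | apply: norm_kernel_act].
- by apply: nkD'; [apply: norm_kernel_diff | apply: norm_kernel_act].
- have hd := norm_kernel_diff g (lincomb y c); have hd' :=
    norm_kernel_diff g (lincomb y' c).
  have hgk := norm_kernel_act g hk; have hgk' := norm_kernel_act g hk'.
  rewrite [LHS](embD h) // [RHS](embD h') // (emb_act h) // (emb_act h') // e.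
  congr (_ + _).
  rewrite -[LHS]/(twist phi (lincomb y c)) -[RHS]/(twist phi' (lincomb y' c)).
  rewrite (twist_lincomb h) (twist_lincomb h').
  by apply: eq_bigr => j _; rewrite hyy.
- by rewrite linearD addrA addrCA subrr addr0.
- by rewrite linearD addrA addrCA subrr addr0.
Qed.

Lemma glue_iso (M M' : gmodule O C) (phi : M -> L) (phi' : M' -> L)
    (y : 'I_n -> M) (y' : 'I_n -> M') :
  norm_kernel_iso iO g w a phi -> norm_kernel_iso iO g w a phi' ->
  is_complement_basis (norm_kernel M) y -> is_complement_basis (norm_kernel M') y' ->
  (forall j, twist phi (y j) = twist phi' (y' j)) ->
  gm_iso M M'.
Proof.
move=> h h' hy hy' hyy.
have [F hF] := choice (fun m => glue_total y' m h h' hy).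
have [G hG] := choice (fun m => glue_total y m h' h hy').
have Flin : linear F.
  move=> o m m'; apply: (glue_unique h' hy (hF _)).
  by apply: (glue_linear _ h h').
have FK : cancel F G.
  by move=> m; apply: (glue_unique h hy' (hG _)); apply: glue_sym.
have GK : cancel G F.
  by move=> m; apply: (glue_unique h' hy (hF _)); apply: glue_sym.
have Fg m : F (gm_act g m) = gm_act g (F m).
  by apply: (glue_unique h' hy (hF _)); apply: glue_act.
pose f : {linear M -> M'} := HB.pack F (GRing.isLinear.Build O M M' _ F Flin).
exists f; first by exists G.
move=> k m; have [i ->] := generator_expg hg k.
rewrite !gm_act_exp; elim: i => //= i <-; exact: Fg.
Qed.
End Glue.

(** * Existence of the data, and how far they determine the module and conversely *)

Section Data.
Variables (w : L) (a : L -> Prop) (b : L).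
Hypotheses (hw : l.-primitive_root w) (ha : is_fractional_ideal iR a).
Hypothesis hb : is_basis_mod_z1 iR z a b.

(** Working form of the data: the complement is replaced by its basis, and the congruence defining
    the orbit is absorbed into the multiple of z - 1, leaving a unit u. *)
Lemma has_dataP (M : gmodule O C) n (c : R) :
  has_data iO z iR g w M a b n c <->
  exists (phi : M -> L) (y : 'I_n -> M) (u : R),
    [/\ norm_kernel_iso iO g w a phi, is_complement_basis (norm_kernel M) y,
        u \is a GRing.unit
      & forall j : 'I_n, exists2 t, a t &
          twist phi (y j) =
            (if j == 0%N :> nat then iR (u * c) * b else 0) + (z - 1) * t].
Proof.
have hW := norm_kernel_submodule M; have [ab _ _] := hb.
split.
  case=> _ _ [phi [X [y [c0 [hphi hX hy [u uu [t ht]] hj]]]]].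
  exists phi, y, u; split=> //; first exact: complement_basisP hX hy.
  move=> j; have [s as' hs] := hj j; rewrite /twist hs.
  case: ifP => _; last by exists s.
  exists (iR t * b + s); first by apply: (fideal_D ha) => //; apply: (fideal_M ha).
  by rewrite mulrDr mulrA -ht; ring.
case=> phi [y [u [hphi hy uu hj]]].
have [hc hy'] := linspan_complement hW hy.
split; first by exists phi.
  by apply/(rank_complement_basis hW); exists y.
exists phi, (linspan y), y, (u * c); split=> //.
by exists u => //; exists 0; rewrite subrr rmorph0 mulr0.
Qed.

Lemma scalar_lift : exists J : {rmorphism O -> R}, forall o, iR (J o) = (iO o)%:A.
Proof.
have [J hJ] := choice integral_elt_scalar.
have JB : zmod_morphism J.
  by move=> x y; apply: iR_inj; rewrite rmorphB !hJ rmorphB scalerBl.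
have JM : monoid_morphism J.
  split=> [|x y]; apply: iR_inj; first by rewrite hJ !rmorph1 scale1r.
  by rewrite rmorphM !hJ rmorphM -scalerA [RHS]mulr_algl.
pose f : {rmorphism O -> R} := HB.pack J (GRing.isZmodMorphism.Build O R J JB)
  (GRing.isMonoidMorphism.Build O R J JM).
by exists f.
Qed.

Lemma data_exists (M : gmodule O C) : is_fg_free M -> has_ideal iO g w M a ->
  exists n c, has_data iO z iR g w M a b n c.
Proof.
move=> hM [phi hphi]; have hW := norm_kernel_submodule M.
have [hemb himg] := hphi; have [ab hspan _] := hb.
have [n0 [y0 hy0]] := norm_kernel_complement_basis hpid hM.
have htw m : a (twist phi m).
  by apply/himg; exists (gm_act g m - m) => //; apply: norm_kernel_diff.
(* Residues are lifted to O rather than to R, so that the elimination takes place over the principal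
   ideal domain O. *)
have hf0 j : exists o, exists2 t, a t & twist phi (y0 j) = iO o *: b + (z - 1) * t.
  have [r [t [at' ht]]] := hspan _ (htw (y0 j)).
  have [o [s hs]] := residue_scalar r; exists o, (iR s * b + t).
    by apply: (fideal_D ha) => //; apply: (fideal_M ha).
  by rewrite ht -[_ *: b]mulr_algl mulrDr mulrA -hs; ring.
have [f hf] := fin_all_exists hf0.
have [n [y [k [hy hk hk0]]]] := complement_basis_adapted hW f hpid hy0.
have hty j : exists2 t, a t &
    twist phi (y j) = iO (\sum_i k j 0 i * f i) *: b + (z - 1) * t.
  have [t ht et] := fin_all_exists2 hf.
  exists (\sum_i iO (k j 0 i) *: t i).
    elim/big_ind: _ => [|x x'|i _]; [exact: (fideal_0 ha) | exact: (fideal_D ha) |].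
    by apply: (fideal_Z ha).
  rewrite hk (twist_lincomb hemb) rmorph_sum scaler_suml mulr_sumr -big_split.
  apply: eq_bigr => i _; rewrite et scalerDr rmorphM scalerA scalerAr.
  by [].
have [c hc] : exists c : R, forall j : 'I_n, j == 0%N :> nat ->
    iR c = (iO (\sum_i k j 0 i * f i))%:A.
  (* With n = 0 there is no condition, and c = 0 is an arbitrary choice. *)
  case: n y k hy hk hk0 hty => [|n] y k hy hk hk0 hty; first by exists 0 => -[].
  have [c hc] := integral_elt_scalar (\sum_i k ord0 0 i * f i); exists c => j /eqP hj.
  by rewrite hc (_ : j = ord0) //; apply: val_inj.
exists n, c; apply/has_dataP; exists phi, y, 1; split=> // [|j].
  exact: unitr1.
have [t at' ht] := hty j; exists t => //; rewrite ht mul1r; case: ifP => hj.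
  by rewrite (hc _ hj) mulr_algl.
by rewrite hk0 ?hj // rmorph0 scale0r.
Qed.

Lemma same_data_iso (M M' : gmodule O C) n c :
  has_data iO z iR g w M a b n c -> has_data iO z iR g w M' a b n c -> gm_iso M M'.
Proof.
case/has_dataP => phi [y [u [[h himg] hy uu hj]]].
case/has_dataP => phi' [y' [u' [hphi' hy' uu' hj']]].
have hW' := norm_kernel_submodule M'; have [h' himg'] := hphi'.
(* Rescaling phi by this unit keeps its image a and makes the leading coefficients u c and u' c
   agree. *)
pose v := u' / u.
have uv : v \is a GRing.unit by rewrite unitrM uu' unitrV uu.
have vK x : iR v * (iR v^-1 * x) = x by rewrite mulrA -rmorphM divrr // rmorph1 mul1r.
have v0 : iR v != 0.
  by apply/eqP => e; move: (vK 1); rewrite e mul0r => /eqP; rewrite eq_sym oner_eq0.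
have hv : norm_kernel_iso iO g w a (fun m => iR v * phi m).
  split.
    split.
    - by move=> m m' hm hm'; rewrite (embD h) // mulrDr.
    - by move=> o m hm; rewrite (embZ h) // scalerAr.
    - by move=> m hm; rewrite (emb_act h) // mulrCA.
    - move=> m hm /eqP; rewrite mulf_eq0 (negbTE v0) => /eqP.
      by case: h => _ _ _; apply.
  move=> x; split=> [ax|[m hm <-]]; last by apply: (fideal_M ha); apply/himg; exists m.
  have /himg [m hm e] := fideal_M ha v^-1 ax.
  by exists m => //; rewrite e vK.
(* The twists now agree modulo (z - 1) a = (w - 1) a. Shifting y' j by an element m of the norm
   kernel adds (w - 1) phi' m, which absorbs the difference. *)
have hz1 j : exists2 m, norm_kernel M' m &
    iR v * twist phi (y j) = twist phi' (y' j) + (w - 1) * phi' m.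
  have [t at' ->] := hj j; have [t' at'' ->] := hj' j.
  have [s [hs es]] := root_of_unity_dvd hw hz.
  have /himg' [m hm e] : a (s * (iR v * t - t')).
    apply: (fideal_integral ha) hs _; apply: (fideal_D ha); last exact: (fideal_N ha).
    exact: (fideal_M ha).
  exists m => //; rewrite e [(w - 1) * _]mulrA [(w - 1) * s]mulrC -es.
  have -> : iR (u' * c) = iR v * iR (u * c) by rewrite -rmorphM mulrA divrK.
  by case: ifP => _; ring.
have [m hm em] := fin_all_exists2 hz1.
apply: (glue_iso (y' := fun j => y' j + m j) hv hphi' hy).
  apply: (complement_basis_shift hW' hy') => j; rewrite opprD addNKr.
  by rewrite -scaleN1r; case: hW' => _ _; apply.
move=> j; rewrite [LHS]em /twist linearD /= opprD addrACA [RHS](embD h').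
- have hmg := norm_kernel_act g (hm j).
  by rewrite (embB h' hmg (hm j)) (emb_act h') // mulrBl mul1r.
- exact: norm_kernel_diff.
- exact: norm_kernel_diff.
Qed.

Lemma data_unique (M : gmodule O C) n c c' :
  has_data iO z iR g w M a b n c -> has_data iO z iR g w M a b n c' ->
  (n = 1%N -> same_orbit iR z c c') /\ ((0 < n)%N -> same_residue_orbit iR z c c').
Proof.
have [n0|n_gt0] := posnP n; first by rewrite n0.
case/has_dataP => phi [y [u [[h himg] hy uu hj]]].
case/has_dataP => phi' [y' [u' [[h' himg'] hy' uu' hj']]].
have hW := norm_kernel_submodule M; have [ab _ bfree] := hb.
case: (ha) => -[x0 ax0 x0n] _ _ _.
have /himg [m0 hm0 e0] := ax0.
have [|t t0 ht] := embedding_ratio hw h h' hm0; first by rewrite e0.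
have ta x : a x -> a (t * x).
  by case/himg => m hm <-; apply/himg'; exists m; rewrite ?ht.
have ta' x : a x -> a (t^-1 * x).
  by case/himg' => m hm <-; apply/himg; exists m; rewrite ?ht ?mulKf.
have [v hv] := fideal_stable_integral ha ta.
have [v' hv'] := fideal_stable_integral ha ta'.
have vv' : v * v' = 1 by apply: iR_inj; rewrite rmorphM hv hv' divff ?rmorph1.
have [A [B [AB BA hB]]] := complement_basis_change hW hy hy'.
have [J hJ] := scalar_lift.
pose i0 : 'I_n := Ordinal n_gt0.
have isi0 (j : 'I_n) : (j == 0%N :> nat) = (j == i0) by [].
(* The twist of y' j is computed in two ways: directly, and as v times the combination of twists of
   y given by row j of B. The remaining part of y' j lies in M_N and contributes a multiple of w -
   1. Coefficients of b are compared. *)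
have key j : eq_mod_z1 iR z (if j == i0 then u' * c' else 0) (v * J (B j i0) * (u * c)).
  have [s hs es] : exists2 s, a s &
      twist phi (y' j) = iO (B j i0) *: (iR (u * c) * b) + (z - 1) * s.
    have [t1 ht1 et1] := fin_all_exists2 hj.
    have [q [hq eq]] := root_of_unity_dvd hz hw.
    pose m := y' j - lincomb y (row j B); have hm : norm_kernel M m by apply: hB.
    exists (\sum_k iO (B j k) *: t1 k + q * phi m).
      apply: (fideal_D ha); last by apply: (fideal_integral ha) => //; apply/himg;
        exists m.
      elim/big_ind: _ => [|x x'|k _]; [exact: (fideal_0 ha) | exact: (fideal_D ha) |].
      exact: (fideal_Z ha).
    have -> : y' j = 1 *: lincomb y (row j B) + m by rewrite scale1r addrC subrK.
    rewrite (twist_linear h) rmorph1 scale1r (twist_lincomb h) {2}/twist.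
    rewrite (embB h (norm_kernel_act g hm) hm) (emb_act h) //.
    have -> : w * phi m - phi m =
      (z - 1) * (q * phi m) by rewrite mulrA [_ * q]mulrC -eq; ring.
    rewrite mulrDr addrA; congr (_ + _); rewrite mulr_sumr.
    rewrite (bigD1 i0) //= et1 isi0 eqxx [in RHS](bigD1 i0) //= mxE scalerDr -addrA -scalerAr.
    congr (_ + (_ + _)); apply: eq_bigr => k /negbTE hk.
    by rewrite et1 isi0 hk add0r mxE scalerAr.
  have [t' ht' et'] := hj' j.
  have : twist phi' (y' j) = t * twist phi (y' j) by apply: ht; apply: norm_kernel_diff.
  rewrite et' es isi0 => e.
  have /bfree : a (t * s - t') by apply: (fideal_D ha) (ta _ hs) (fideal_N ha ht').
  case/(_ ((if j == i0 then u' * c' else 0) - v * J (B j i0) * (u * c))) => [|q].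
    have -> : (z - 1) * (t * s - t') =
        (if j == i0 then iR (u' * c') * b else 0) - t * (iO (B j i0) *: (iR (u * c) * b)).
      move/eqP: e; rewrite mulrDr -subr_eq => /eqP <-; ring.
    rewrite rmorphB mulrBl !rmorphM hJ hv -[_ *: (_ * b)]mulr_algl.
    by case: ifP => _; rewrite ?rmorphM ?rmorph0 ?mul0r; congr (_ - _); ring.
  by rewrite rmorph0 subr0 => hq; exists q; rewrite -hq rmorphB.
have congM p q r : eq_mod_z1 iR z q r -> eq_mod_z1 iR z (p * q) (p * r).
  by move=> hqr; rewrite /eq_mod_z1 !rmorphM; apply: congMl.
have hc' r : eq_mod_z1 iR z (J (B i0 i0) * (u * c)) (r * (u * c)) ->
    eq_mod_z1 iR z c' (u'^-1 * v * r * u * c).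
  move=> hr; have := key i0; rewrite eqxx => /(congM u'^-1); rewrite mulKr // => h1.
  apply: cong_trans h1 _; rewrite -!mulrA; apply: (congM); apply: (congM).
  exact: hr.
have uv : v \is a GRing.unit by apply/unitrPr; exists v'.
have AB1 : \sum_k A i0 k * B k i0 = 1.
  by have := congr1 (fun X : 'M_n => X i0 i0) AB; rewrite !mxE eqxx.
split=> [n1|_].
  exists (u'^-1 * v * J (B i0 i0) * u); last by apply: hc'; apply: cong_refl.
  rewrite !unitrM unitrV uu uu' uv andbT /=; apply: rmorph_unit.
  (* For n = 1 the transition matrices are scalars inverse to each other. *)
  apply/unitrPr; exists (A i0 i0).
  rewrite -AB1 (bigD1 i0) //= big1 ?addr0 1?mulrC // => k /negP [].
  by apply/eqP/val_inj => /=; case: k => k /=; rewrite n1; case: k.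
(* In the sum of the A i0 k * B k i0, which is 1, only k = i0 survives against u c: by [key] the
   other B k i0 annihilate it modulo z - 1. *)
have one : eq_mod_z1 iR z (u * c) (J (A i0 i0) * J (B i0 i0) * (u * c)).
  have esum : \sum_k J (A i0 k) * J (B k i0) * (u * c) = u * c.
    rewrite -mulr_suml (eq_bigr (fun k => J (A i0 k * B k i0))); last first.
      by move=> k _; rewrite rmorphM.
    rewrite -rmorph_sum.
    by rewrite AB1 rmorph1 mul1r.
  rewrite -{1}esum (bigD1 i0) //= -[X in eq_mod_z1 _ _ _ X]addr0 /eq_mod_z1 !rmorphD.
  apply: (congD (cong_refl _)).
  elim/big_ind: _ => [|p q hp hq|k /negbTE hk]; first exact: cong_refl.
    by rewrite rmorphD -[iR 0]addr0 -{1}(rmorph0 iR); apply: congD.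
  apply: cong_sym; have := congM (J (A i0 k) * v') _ _ (key k); rewrite hk mulr0.
  suff -> : J (A i0 k) * v' * (v * J (B k i0) * (u * c)) =
    v * v' * (J (A i0 k) * J (B k i0) * (u * c)).
    by rewrite vv' mul1r.
  ring.
(* B i0 i0 need not be a unit modulo l. Adding a multiple of 1 - B i0 i0 * A i0 i0, which kills u c
   by [one], makes it one without changing its effect on c. *)
have [s [r [q hsr]]] := pid_unit_lift hpid (B i0 i0) (A i0 i0) l_neq0.
have hJsr := congr1 J hsr.
exists (u'^-1 * v * J (B i0 i0 + s * (1 - B i0 i0 * A i0 i0)) * u), (u^-1 * J r * v' * u').
split; last first.
  apply: hc'.
  have [t1 ht1] := congM (J s) _ _ one; exists (- t1).
  rewrite rmorphN mulrN -ht1 -!(rmorphB iR) -(rmorphN iR); congr (iR _).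
  by rewrite !rmorphD !rmorphM !rmorphB rmorphM rmorph1; ring.
have -> : u'^-1 * v * J (B i0 i0 + s * (1 - B i0 i0 * A i0 i0)) * u * (u^-1 * J r * v' * u') =
    (u' / u') * (u / u) * (v * v') * J ((B i0 i0 + s * (1 - B i0 i0 * A i0 i0)) * r).
  by rewrite rmorphM; ring.
rewrite !divrr // vv' !mul1r hsr rmorphD rmorph1 rmorphM.
rewrite /eq_mod_z1 rmorphD -[X in _ - X]addr0.
apply: (congD (cong_refl _)).
rewrite rmorphM [iR (J l%:R)]hJ; have := congMl (J q) prime_cong0.
by rewrite mulr0.
Qed.
End Data.

(** * Invariance of the data under isomorphism *)

Lemma gm_iso_inverse (M M' : gmodule O C) : gm_iso M M' ->
  exists (f : {linear M -> M'}) (f' : {linear M' -> M}), [/\ cancel f f', cancel f' f,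
    forall h m, f (gm_act h m) = gm_act h (f m)
    & forall h m, f' (gm_act h m) = gm_act h (f' m)].
Proof.
case=> f [f0 fK Kf] hf.
have lin0 := can2_linear fK Kf.
pose f' : {linear M' -> M} := HB.pack f0 (GRing.isLinear.Build O M' M _ f0 lin0).
exists f, f'; split=> // h m; apply: (can_inj fK).
by rewrite hf -[f' _]/(f0 _) -[f' m]/(f0 m) !Kf.
Qed.

Lemma gm_iso_sym (M M' : gmodule O C) : gm_iso M M' -> gm_iso M' M.
Proof.
by case/gm_iso_inverse => f [f' [fK Kf _ hf']]; exists f' => //; exists f.
Qed.

Lemma gm_iso_data w (a : L -> Prop) b (M M' : gmodule O C) n c :
  is_fractional_ideal iR a -> is_basis_mod_z1 iR z a b -> gm_iso M M' ->
  has_data iO z iR g w M a b n c -> has_data iO z iR g w M' a b n c.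
Proof.
move=> ha hb /gm_iso_inverse [f [f' [fK Kf hf hf']]].
case/(has_dataP _ ha hb) => phi [y [u [[h himg] [hs hfree] uu hj]]].
have Nf' m : norm_elt (f' m) = f' (norm_elt m).
  by rewrite /norm_elt linear_sum; apply: eq_bigr => k _; rewrite hf'.
have nkf' m : norm_kernel M' m -> norm_kernel M (f' m).
  by move/norm_kernelE => hm; apply/norm_kernelE; rewrite Nf' hm linear0.
have nkf m : norm_kernel M (f' m) -> norm_kernel M' m.
  by move/norm_kernelE; rewrite Nf' => /(congr1 f); rewrite Kf linear0.
have f'y c' : f' (lincomb (f \o y) c') = lincomb y c'.
  by rewrite /lincomb linear_sum; apply: eq_bigr => j _; rewrite linearZ /= fK.
apply/(has_dataP _ ha hb); exists (phi \o f'), (f \o y), u; split=> //.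
- split.
    split=> [m m' hm hm'|o m hm|m hm|m hm e] /=.
    + by rewrite linearD (embD h) //; apply: nkf'.
    + by rewrite linearZ (embZ h) //; apply: nkf'.
    + by rewrite hf' (emb_act h) //; apply: nkf'.
    + apply: (can_inj Kf); rewrite linear0; case: h => _ _ _; apply=> //; exact: nkf'.
  move=> x; split=> [/himg [m hm <-]|[m hm <-]].
    by exists (f m); rewrite /= ?fK //; apply: nkf; rewrite fK.
  by apply/himg; exists (f' m) => //; apply: nkf'.
- split=> [m|c' /nkf'].
    have [c' hc'] := hs (f' m); exists c'; apply: nkf.
    by rewrite linearB /= f'y.
  by rewrite f'y; apply: hfree.
- move=> j; have [t at' ht] := hj j; exists t => //; rewrite -ht /twist /=.
  by rewrite linearB /= hf' fK.
Qed.

(** The analogue of [lincomb] in L, which is a vector space over K and receives scalars from O only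
    through [iO]. *)
Definition oscale_sum N (e : 'I_N -> L) (v : 'rV[O]_N) : L := \sum_i iO (v 0 i) *: e i.

Lemma oscale_sumP N (e : 'I_N -> L) o v v' :
  oscale_sum e (o *: v + v') = iO o *: oscale_sum e v + oscale_sum e v'.
Proof.
rewrite /oscale_sum scaler_sumr -big_split; apply: eq_bigr => i _ /=.
by rewrite !mxE rmorphD rmorphM scalerDl scalerA.
Qed.

Lemma oscale_sum0 N (e : 'I_N -> L) : oscale_sum e 0 = 0.
Proof. by rewrite /oscale_sum big1 // => i _; rewrite mxE rmorph0 scale0r. Qed.

Lemma oscale_sumD N (e : 'I_N -> L) v v' :
  oscale_sum e (v + v') = oscale_sum e v + oscale_sum e v'.
Proof. by have := oscale_sumP e 1 v v'; rewrite scale1r rmorph1 scale1r. Qed.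

Lemma oscale_sumZ N (e : 'I_N -> L) o v : oscale_sum e (o *: v) = iO o *: oscale_sum e v.
Proof. by have := oscale_sumP e o v 0; rewrite !addr0 oscale_sum0 addr0. Qed.

Lemma oscale_sum_mul N N' (e : 'I_N -> L) (v : 'rV[O]_N') (A : 'M_(N', N)) :
  oscale_sum e (v *m A) = oscale_sum (fun i => oscale_sum e (row i A)) v.
Proof.
rewrite mulmx_sum_row /oscale_sum.
have := big_morph (oscale_sum e) (oscale_sumD e) (oscale_sum0 e).
rewrite /oscale_sum => ->; apply: eq_bigr => i _.
exact: (oscale_sumZ e).
Qed.

(** Uniform in r: exponents of z reduce modulo l, so only the coordinates of l powers of z have to
    be cleared. *)
Lemma coord_denominator : exists o, o != 0 /\
  forall i r, exists p, iO o * coord (vbasis {:L}) i (iR r) = iO p.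
Proof.
pose B := vbasis {:L}.
have [||o [o0 ho]] := common_denominator
    (P := fun i o => forall k : 'I_l, exists p, iO o * coord B i (z ^+ k) = iO p).
- move=> i; apply: (common_denominator (P :=
    fun k o => exists p, iO o * coord B i (z ^+ k) = iO p)).
    by move=> k; have [o [p [o0 hp]]] := iO_frac (coord B i (z ^+ k)); exists o;
      split=> //; exists p.
  by move=> k o o' [p hp]; exists (o' * p); rewrite !rmorphM -mulrA hp.
- by move=> i o o' h k; have [p hp] := h k; exists (o' * p); rewrite !rmorphM -mulrA hp.
exists o; split=> // i r; have [p ->] := integral_elt_poly r.
rewrite horner_coef linear_sum mulr_sumr.
elim/big_ind: _ => [|x y [s ->] [t ->]|k _]; first by exists 0; rewrite rmorph0.
  by exists (s + t); rewrite rmorphD.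
rewrite coef_map /= mulr_algl linearZ /= mulrCA -(expr_mod _ (prim_expr_order hz)).
have hk : (k %% l < l)%N by rewrite ltn_mod prime_gt0.
have [s hs] := ho i (Ordinal hk); rewrite /= in hs; rewrite hs.
by exists (p`_k * s); rewrite rmorphM.
Qed.

Lemma fideal_free (a : L -> Prop) : is_fractional_ideal iR a ->
  exists N (e : 'I_N -> L), (forall x, a x <-> exists v, x = oscale_sum e v) /\
    forall v, oscale_sum e v = 0 -> v = 0.
Proof.
move=> ha; case: (ha) => _ _ _ [d d0 hd].
have [o1 [o10 [r hr]]] := fraction_L (iR d)^-1.
have [o2 [o20 ho2]] := coord_denominator.
(* o1 / d is in R and d a lies in R, so o1 a lies in R; o2 clears the coordinates of R. Thus s a
   lies in the O-span of a K-basis of L, and a is free as a submodule of a free module. *)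
pose s : L := (iO (o2 * o1))%:A.
have s0 : s != 0.
  rewrite scaler_eq0 oner_eq0 orbF; apply: contraNneq (mulf_neq0 o20 o10) => e.
  by apply/eqP/iO_inj; rewrite e rmorph0.
pose B := vbasis {:L}; pose E := oscale_sum (fun i : 'I_(\dim {:L}) => B`_i).
have Einj v : E v = 0 -> v = 0.
  move=> e; apply/rowP=> i; rewrite mxE; apply: iO_inj; rewrite rmorph0.
  have /freeP hB := basis_free (vbasisP {:L}).
  exact: (hB (fun i => iO (v 0 i)) e).
have Esurj x : a x -> exists v, s * x = E v.
  move=> ax; have [r1 hr1] := hd _ ax.
  have d0' : iR d != 0 by rewrite -(rmorph0 iR) (inj_eq iR_inj).
  have hx : s * x = iO o2 *: iR (r * r1).
    rewrite /s rmorphM mulr_algl -scalerA; congr (_ *: _).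
    by rewrite rmorphM hr -hr1 mulrA divfK // mulr_algl.
  have [v hv] := fin_all_exists (fun i => ho2 i (r * r1)).
  exists (\row_i v i); rewrite hx {1}(coord_vbasis (memvf (iR (r * r1)))) scaler_sumr.
  by apply: eq_bigr => i _; rewrite mxE scalerA hv.
pose W v := a (s^-1 * E v).
have hW : is_submodule W.
  split; rewrite /W.
  - by rewrite /E oscale_sum0 mulr0; apply: fideal_0 ha.
  - by move=> v v' hv hv'; rewrite /E oscale_sumD mulrDr; apply: (fideal_D ha).
  - by move=> o v hv; rewrite /E oscale_sumZ -scalerAr; apply: (fideal_Z ha).
have [||N [y hy]] := pid_submodule_basis hpid (f :=
  fun i (v : 'rV[O]_(\dim {:L})) => v 0 i) hW.
- by move=> i o v v' _ _; rewrite !mxE.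
- by move=> v _ h; apply/rowP => i; rewrite h mxE.
have Ey v : oscale_sum (fun j => s^-1 * E (y j)) v = s^-1 * E (lincomb y v).
  rewrite /lincomb (big_morph E (oscale_sumD _) (oscale_sum0 _)) mulr_sumr.
  by apply: eq_bigr => j _; rewrite /E oscale_sumZ scalerAr.
exists N, (fun j => s^-1 * E (y j)); split=> [x|v].
  split=> [ax|[v ->]].
    have [v hv] := Esurj _ ax.
    have [|c hc] := is_basis_span (m := v) hy; first by rewrite /W -hv mulKf.
    by exists c; rewrite Ey -hc -hv mulKf.
  by rewrite Ey; apply: (lincomb_in v hW); case: hy.
rewrite Ey => /eqP; rewrite mulf_eq0 invr_eq0 (negbTE s0) => /eqP /Einj.
exact: (is_basis_free hW hy).
Qed.

Section Realization.
Variables (w : L) (a : L -> Prop) (b : L) (n : nat) (c : R).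
Hypotheses (hw : l.-primitive_root w) (ha : is_fractional_ideal iR a).
Hypothesis hb : is_basis_mod_z1 iR z a b.

(* On a + O^n, with a identified with O^N along its basis e, the generator acts
   as multiplication by w on a and sends the first basis vector y_0 of O^n to
   y_0 + c b. *)
Lemma data_realized : exists M : gmodule O C,
  [/\ is_fg_free M, norm_kernel_rank1 L iO l g M & has_data iO z iR g w M a b n c].
Proof.
have [N [e [ae einj]]] := fideal_free ha; have [ab _ _] := hb.
have we i : exists v, w * e i = oscale_sum e v.
  apply/ae; have [k ->] := root_of_unity_power hz hw.
  apply: (fideal_integral ha (integral_elt_exp k)); apply/ae; exists (delta_mx 0 i).
  rewrite /oscale_sum (bigD1 i) //= mxE !eqxx rmorph1 scale1r big1 ?addr0 // => j /negbTE ji.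
  by rewrite mxE ji andbF rmorph0 scale0r.
have [W hW] := fin_all_exists we.
have [k0 hk0] : exists v, iR c * b = oscale_sum e v by apply/ae; apply: (fideal_M ha).
pose T (v : 'rV[O]_n) :=
  oscale_sum (fun j : 'I_n => if j == 0%N :> nat then iR c * b else 0) v.
pose D : 'M[O]_(n, N) := \matrix_(j < n) (if j == 0%N :> nat then k0 else 0).
pose G : 'M[O]_(N + n) := block_mx (\matrix_i W i) 0 D 1%:M.
pose E (v : 'rV[O]_(N + n)) := oscale_sum e (lsubmx v).
have ED v v' : E (v + v') = E v + E v' by rewrite /E linearD oscale_sumD.
have EZ o v : E (o *: v) = iO o *: E v by rewrite /E linearZ /= oscale_sumZ.
have T0 : T 0 = 0 by apply: oscale_sum0.
have EG v : E (v *m G) = w * E v + T (rsubmx v).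
  rewrite /E -{1}(hsubmxK v) mul_row_block row_mxKl oscale_sumD !oscale_sum_mul.
  congr (_ + _); rewrite /T /oscale_sum; last first.
    apply: eq_bigr => j _; congr (_ *: _); rewrite rowK; case: ifP => _ //.
    exact: oscale_sum0.
  rewrite mulr_sumr; apply: eq_bigr => j _.
  by rewrite -scalerAr hW rowK.
have rG v : rsubmx (v *m G) = rsubmx v.
  by rewrite -{1}(hsubmxK v) mul_row_block row_mxKr mulmx0 add0r mulmx1.
have Einj v v' : E v = E v' -> rsubmx v = rsubmx v' -> v = v'.
  move=> h1 h2; rewrite -(hsubmxK v) -(hsubmxK v') h2; congr row_mx.
  apply/eqP; rewrite -subr_eq0; apply/eqP/einj.
  have := oscale_sumP e (-1) (lsubmx v') (lsubmx v).
  by rewrite rmorphN1 !scaleN1r -/(E v) -/(E v') h1 addNr [- _ + _]addrC.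
have rGk k v : rsubmx (v *m G ^+ k) = rsubmx v.
  elim: k v => [|k IH] v; first by rewrite expr0 mulmx1.
  by rewrite exprS -mulmxE mulmxA IH rG.
(* Powers of G act on the a-component through w^k and a geometric sum in w. At k = l the sum
   vanishes, whence G^l = 1. *)
have EGk k v : E (v *m G ^+ k) = w ^+ k * E v + (\sum_(i < k) w ^+ i) * T (rsubmx v).
  elim: k => [|k IH]; first by rewrite !expr0 mulmx1 mul1r big_ord0 mul0r addr0.
  rewrite exprSr -mulmxE mulmxA EG IH rGk big_ord_recl expr0.
  rewrite [in RHS](eq_bigr (fun i : 'I_k => w * w ^+ i)) => [|i _];
    last by rewrite lift0 exprS.
  by rewrite -mulr_sumr exprS; ring.
have w1 : w - 1 != 0.
  have [s [_ es]] := root_of_unity_dvd hw hz.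
  by apply: contraNneq z1_neq0 => h; rewrite es h mulr0.
have wsum : \sum_(i < l) w ^+ i = 0.
  by apply: (mulfI w1); rewrite -subrX1 (prim_expr_order hw) subrr mulr0.
have Gl : G ^+ l = 1.
  have hv (v : 'rV_(N + n)) : v *m G ^+ l = v.
    apply: Einj; last exact: rGk.
    by rewrite EGk wsum mul0r addr0 (prim_expr_order hw) mul1r.
  by apply/row_matrixP => i; rewrite [LHS]rowE hv [RHS]rowE mulmx1.
(* An element of C acts by G raised to any exponent that writes it as a power of g; G^l = 1 makes
   this independent of the exponent. *)
have [k hk] := choice (generator_expg hg).
have Geq i j : (g ^+ i = g ^+ j)%g -> G ^+ i = G ^+ j.
  move/eqP; rewrite eq_expg_mod_order.
  have -> : #[g]%g = l by rewrite -hC -cardsT (eqP hg).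
  by move/eqP => ij; rewrite -(expr_mod i Gl) ij expr_mod.
pose act h : {linear 'rV[O]_(N + n) -> 'rV[O]_(N + n)} := mulmxr (G ^+ k h).
have act1 v : act 1%g v = v.
  by rewrite /act /= (Geq (k 1%g) 0%N) ?expr0 ?mulmx1 // -hk expg0.
have actM h h' v : act (h * h')%g v = act h (act h' v).
  rewrite /act /= -mulmxA; congr (_ *m _); rewrite mulmxE -exprD; apply: Geq.
  by rewrite -hk addnC expgD -!hk.
pose M := GModule act1 actM.
have actg v : act g v = v *m G.
  by rewrite /act /= (Geq (k g) 1%N) ?expr1 // -hk expg1.
have rN v : rsubmx (norm_elt (M := M) v) = l%:R *: rsubmx v.
  rewrite /norm_elt linear_sum (eq_bigr (fun _ => rsubmx v)); last by move=> h _;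
    apply: rGk.
  by rewrite sumr_const hC scaler_nat.
(* The norm multiplies the component in O^n by l, which is nonzero in O. Conversely, if that
   component is 0, the norm of v lies in a and is fixed by g, so w - 1 kills it. *)
have nkP v : norm_kernel M v <-> rsubmx v = 0.
  split=> [/norm_kernelE hv|hv].
    have := rN v; rewrite hv linear0 => /rowP h; apply/rowP=> i; apply: (mulfI l_neq0).
    by have := h i; rewrite !mxE => <-; rewrite mulr0.
  apply/norm_kernelE.
  have rNv : rsubmx (norm_elt (M := M) v) = 0 by rewrite rN hv scaler0.
  apply: Einj; last by rewrite rNv linear0.
  have := congr1 E (act_norm_elt (M := M) g v);
    rewrite [gm_act g _]actg EG rNv T0 addr0 => h.
  rewrite [RHS](_ : _ = 0); last by rewrite /E linear0 oscale_sum0.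
  by apply: (mulfI w1); rewrite mulrBl h mul1r subrr mulr0.
have Eemb : norm_kernel_embedding iO g w (E : M -> L).
  split=> [v v' _ _|o v _|v /nkP hv|v /nkP hv Ev].
  - exact: ED.
  - exact: EZ.
  - by rewrite [gm_act g v]actg EG hv T0 addr0.
  - apply: Einj; last by rewrite hv linear0.
    by rewrite Ev /E linear0 oscale_sum0.
have Eiso : norm_kernel_iso iO g w a (E : M -> L).
  split=> // x; split=> [/ae [v ->]|[v _ <-]]; last by apply/ae; exists (lsubmx v).
  exists (row_mx v 0); first by apply/nkP; rewrite row_mxKr.
  by rewrite /E row_mxKl.
exists M; split.
- exists (N + n)%N, (fun j => delta_mx 0 j : M); apply: is_basis_intro => //.
    by move=> v _; exists v; rewrite [LHS]row_sum_delta.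
  by move=> v hv; rewrite -[RHS]hv [LHS]row_sum_delta.
- exists w, E; split=> // x; case: (ha) => -[x0 ax0 x0n] _ _ _.
  have [o [o0 [r hr]]] := fraction_L (x / x0).
  have /(proj2 Eiso) [v hv ev] := fideal_M ha r ax0.
  by exists o, v; split=> //; rewrite ev hr -mulrA divfK // mulr_algl.
apply/(has_dataP _ ha hb); exists E, (fun j => row_mx 0 (delta_mx 0 j) : M), 1.
have yc v : lincomb (fun j => row_mx 0 (delta_mx 0 j) : M) v = row_mx 0 v.
  rewrite -[LHS](hsubmxK (lincomb _ v : 'rV[O]_(N + n))) /lincomb !linear_sum.
  congr row_mx; first by apply: big1 => j _; rewrite linearZ /= row_mxKl scaler0.
  rewrite [RHS]row_sum_delta; apply: eq_bigr => j _.
  by rewrite linearZ /= row_mxKr.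
split=> //; [|exact: unitr1|].
- split=> [v|v].
    by exists (rsubmx v); apply/nkP; rewrite yc linearB /= row_mxKr subrr.
  by rewrite yc => /nkP; rewrite row_mxKr.
move=> j; exists 0; first exact: (fideal_0 ha).
rewrite mulr0 addr0 mul1r /twist [gm_act g _]actg -scaleN1r ED EZ EG row_mxKr.
rewrite {1 2}/E row_mxKl oscale_sum0 mulr0 scaler0 addr0 add0r.
rewrite /T /oscale_sum (bigD1 j) //= mxE !eqxx rmorph1 scale1r big1 ?addr0 // => i /negbTE ij.
by rewrite mxE ij andbF rmorph0 scale0r.
Qed.
End Realization.
End CyclotomicOrder.

Theorem proposition4p7
  (K : fieldExtType rat) (s : nat) (S : 'I_s -> finite_place K)
  (O : idomainType) (iO : {rmorphism O -> K}) (hO : is_S_integer_ring S iO)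
  (l : nat) (hl : prime l)
  (L : fieldExtType K) (z : L) (hz : l.-primitive_root z)
  (hL : <<1%VS; z>>%VS = fullv)
  (R : idomainType) (iR : {rmorphism R -> L}) (hR : is_adjunction iO z iR)
  (C : finGroupType) (g : C) (hC : #|C| = l) (hg : generator [set: C] g)
  (hpid : is_pid O) (hded : is_dedekind R) :
  (* a/(z-1)a is free of rank 1 over R/(z-1), for every fractional ideal a *)
  (forall a : L -> Prop, is_fractional_ideal iR a ->
     exists b, is_basis_mod_z1 iR z a b) /\
  (* every module in the class has data *)
  (forall M : gmodule O C, is_fg_free M -> norm_kernel_rank1 L iO l g M ->
     (exists (w : L) (a : L -> Prop),
        [/\ l.-primitive_root w, is_fractional_ideal iR a &
            has_ideal iO g w M a]) /\
     (forall (w : L) (a : L -> Prop) (b : L),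
        l.-primitive_root w -> is_fractional_ideal iR a ->
        has_ideal iO g w M a -> is_basis_mod_z1 iR z a b ->
        exists (n : nat) (c : R), has_data iO z iR g w M a b n c)) /\
  (* two modules in the class are isomorphic iff they have the same data *)
  (forall M M' : gmodule O C,
     is_fg_free M -> norm_kernel_rank1 L iO l g M ->
     is_fg_free M' -> norm_kernel_rank1 L iO l g M' ->
     (gm_iso M M' ->
        forall (w : L) (a : L -> Prop) (b : L) (n : nat) (c : R),
          l.-primitive_root w -> is_fractional_ideal iR a ->
          is_basis_mod_z1 iR z a b ->
          (has_data iO z iR g w M a b n c <->
           has_data iO z iR g w M' a b n c)) /\
     (forall (w : L) (a : L -> Prop) (b : L) (n : nat) (c : R),
        l.-primitive_root w -> is_fractional_ideal iR a ->
        is_basis_mod_z1 iR z a b ->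
        has_data iO z iR g w M a b n c ->
        has_data iO z iR g w M' a b n c ->
        gm_iso M M')) /\
  (* uniqueness of the data of a module in the class *)
  (forall M : gmodule O C, is_fg_free M -> norm_kernel_rank1 L iO l g M ->
     (forall (w : L) (a a' : L -> Prop),
        l.-primitive_root w ->
        is_fractional_ideal iR a -> is_fractional_ideal iR a' ->
        has_ideal iO g w M a ->
        (has_ideal iO g w M a' <-> same_ideal_class a a')) /\
     (forall n n' : nat,
        quotient_has_rank (norm_kernel M) n ->
        quotient_has_rank (norm_kernel M) n' -> n = n') /\
     (forall (w : L) (a : L -> Prop) (b : L) (n : nat) (c c' : R),
        l.-primitive_root w -> is_fractional_ideal iR a ->
        is_basis_mod_z1 iR z a b ->
        has_data iO z iR g w M a b n c ->
        has_data iO z iR g w M a b n c' ->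
        (n = 1%N -> same_orbit iR z c c') /\
        ((0 < n)%N -> same_residue_orbit iR z c c'))) /\
  (* all values of the data occur *)
  (forall (w : L) (a : L -> Prop) (b : L) (n : nat) (c : R),
     l.-primitive_root w -> is_fractional_ideal iR a ->
     is_basis_mod_z1 iR z a b ->
     exists M : gmodule O C,
       [/\ is_fg_free M, norm_kernel_rank1 L iO l g M &
           has_data iO z iR g w M a b n c]).
Proof.
have [iO_inj _] := hO.
have iO_frac x := S_integer_fraction x hO.
have l_neq0 : l%:R != 0 :> O := natr_S_integer_neq0 iO (prime_gt0 hl).
split; first by move=> a; apply: (fideal_basis hl l_neq0 hz hR).
split.
  move=> M hM [w [phi [hw hphi hx]]]; split.
    exists w, (fun x => exists2 m, norm_kernel M m & phi m = x); split=> //.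
      exact: (embedding_fideal iO_inj iO_frac l_neq0 hz hL hR hC hphi hw hM hx).
    by exists phi.
  by move=> w' a b hw' ha hid hb; apply: (data_exists hR hpid ha hb hM hid).
split.
  move=> M M' hM _ hM' _; split.
    move=> hiso w a b n c hw ha hb.
    by split; apply: (gm_iso_data ha hb) => //; apply: gm_iso_sym.
  move=> w a b n c hw ha hb.
  exact: (same_data_iso hz hR hg hw ha hb).
split.
  move=> M hM _; split; [|split].
  - by move=> w a a' hw ha _; apply: (has_ideal_class iO_inj iO_frac hz hL hR).
  - by move=> n n'; apply: rank_unique; apply: norm_kernel_submodule.
  move=> w a b n c c' hw ha hb.
  exact: (data_unique iO_inj iO_frac hl l_neq0 hz hL hR hpid hded hw ha hb).
move=> w a b n c hw ha hb.
exact: (data_realized iO_inj iO_frac hl l_neq0 hz hL hR hpid hC hg n c hw ha hb).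
Qed.
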